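(* (a) $C[0,1]$ is a separable rich subspace of the nonseparable space $D[0,1]$. (b) If $K$ is a perfect compact Hausdorff space and $E$ is a Banach space, then $C(K,E)$ is a rich subspace of $C_w(K,E)$. In particular, $C([0,1],\ell_p)$ is a separable rich subspace of the nonseparable space $C_w([0,1],\ell_p)$ if $1<p<\infty$.
   Context: Scalars are real or complex. $D[0,1]$ is the space of bounded scalar functions on $[0,1]$ that are right-continuous and have left limits everywhere and are continuous at $t=1$, with the sup-norm. $C(K,E)$ is the space of norm-continuous functions from $K$ to $E$, and $C_w(K,E)$ is the space of weakly continuous functions from $K$ into $E$, both with the sup-norm $\sup_{t\in K}\|f(t)\|$. A compact space is perfect if it has no isolated points. For a Banach space $W$, $B(W)$ is its closed unit ball and $S(W)$ its unit sphere. A slice of $B(W)$ is a nonvoid set of the form $\{w\in B(W): \operatorname{Re} w^*(w)>\alpha\}$ with $w^*\in W^*$, $\alpha\in\mathbb{R}$. An operator $T\colon W\to V$ between Banach spaces is narrow if for every $x,y\in S(W)$, every $\varepsilon>0$ and every slice $S$ of $B(W)$ containing $y$ there is $v\in S$ with $\|x+v\|>2-\varepsilon$ and $\|T(y-v)\|<\varepsilon$. A closed subspace $Z$ of $W$ is rich in $W$ if the quotient map $q\colon W\to W/Z$ is narrow. *)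

(* Defs.v *)
From HB Require Import structures.
From mathcomp Require Import all_boot all_order all_algebra.
From mathcomp Require Import complex.
From mathcomp Require Import all_classical all_reals all_analysis.

Set Implicit Arguments.
Unset Strict Implicit.
Unset Printing Implicit Defensive.

Import Order.TTheory GRing.Theory Num.Theory.
Import numFieldNormedType.Exports.

Local Open Scope classical_set_scope.
Local Open Scope ring_scope.

Variant scalars := RealScalars | ComplexScalars.

Definition scalar_field (R : realType) (s : scalars) : numFieldType :=
  match s with RealScalars => R | ComplexScalars => R[i] end.

Definition re (R : realType) (s : scalars) : scalar_field R s -> R :=
  match s with RealScalars => fun x => x | ComplexScalars => @complex.Re R end.

(* Norms in [normedModType K] take values in [K], so a real number such as a
   supremum of norms has to be injected into [K]. *)
Definition of_real (R : realType) (s : scalars) : R -> scalar_field R s :=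
  match s with
  | RealScalars => fun x => x
  | ComplexScalars => real_complex R
  end.
Arguments of_real {R} s.

Section scalar_theory.
Context (R : realType) (s : scalars).
Local Notation K := (scalar_field R s).

Lemma re_of_real (r : R) : re (of_real s r) = r.
Proof. by case: s. Qed.

Lemma ler_of_real (a b : R) : (of_real s a <= of_real s b) = (a <= b).
Proof. by case: s => //=; exact: lecR. Qed.

Lemma ltr_of_real (a b : R) : (of_real s a < of_real s b) = (a < b).
Proof. by case: s => //=; exact: ltcR. Qed.

Lemma of_realD (a b : R) : of_real s (a + b) = of_real s a + of_real s b.
Proof. by case: s => //=; rewrite rmorphD. Qed.

Lemma of_realM (a b : R) : of_real s (a * b) = of_real s a * of_real s b.
Proof. by case: s => //=; rewrite rmorphM. Qed.

Lemma of_real0 : of_real s 0 = 0 :> K.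
Proof. by case: s. Qed.

Lemma of_realK (x : K) : x \is Num.real -> of_real s (re x) = x.
Proof. by case: s x => //= x; exact: RRe_real. Qed.

Definition rnorm (V : normedModType K) (x : V) : R := re `|x|.

Section rnorm.
Variable V : normedModType K.
Implicit Types x y : V.

Lemma rnormE x : of_real s (rnorm x) = `|x|.
Proof. by rewrite of_realK// normr_real. Qed.

Lemma rnorm_ge0 x : 0 <= rnorm x.
Proof. by rewrite -(ler_of_real) of_real0 rnormE. Qed.

Lemma ler_rnormD x y : rnorm (x + y) <= rnorm x + rnorm y.
Proof. by rewrite -ler_of_real of_realD !rnormE ler_normD. Qed.

Lemma of_real_inj : injective (@of_real R s).
Proof. by move=> x y /(congr1 (@re R s)); rewrite !re_of_real. Qed.

Lemma rnormZ (a : K) x : rnorm (a *: x) = re `|a| * rnorm x.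
Proof.
by apply: of_real_inj; rewrite of_realM !rnormE normrZ of_realK// normr_real.
Qed.

Lemma rnorm0 : rnorm (0 : V) = 0.
Proof. by apply: of_real_inj; rewrite rnormE normr0 of_real0. Qed.

Lemma rnorm_eq0 x : rnorm x = 0 -> x = 0.
Proof. by move=> x0; apply/normr0_eq0; rewrite -rnormE x0 of_real0. Qed.

Lemma rnormN x : rnorm (- x) = rnorm x.
Proof. by rewrite /rnorm normrN. Qed.

Lemma ler_rnormB_dist x y : `|rnorm x - rnorm y| <= rnorm (x - y).
Proof.
have H (u v : V) : rnorm u - rnorm v <= rnorm (u - v).
  by rewrite lerBlDr; have := ler_rnormD (u - v) v; rewrite subrK.
by rewrite ler_norml; apply/andP; split => //; rewrite lerNl opprB -(opprB y x) rnormN.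
Qed.
End rnorm.
End scalar_theory.

Section function_spaces.
Context (R : realType) (s : scalars) (T : Type).
Local Notation K := (scalar_field R s).
Variable E : normedModType K.

(* A linear space of bounded functions [T -> E]; [sup_normed X] is its type of
   elements, normed by the supremum of the norms of the values. *)
Record boundedFunctions := BoundedFunctions {
  bf_carrier :> set (T -> E) ;
  bf_zero : bf_carrier (fun=> 0) ;
  bf_linear : forall (a : K) f g, bf_carrier f -> bf_carrier g ->
    bf_carrier (fun t => a *: f t + g t) ;
  bf_bounded : bf_carrier `<=` bounded_fun }.

Variable X : boundedFunctions.

Definition bf_pred : {pred T -> E} := mem (bf_carrier X).

Record sup_normed := SupNormed {
  sup_normed_fun :> T -> E ;
  sup_normedP : sup_normed_fun \in bf_pred }.

HB.instance Definition _ := [isSub for sup_normed_fun].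
HB.instance Definition _ := [Choice of sup_normed by <:].

Lemma bf_submod_closed : submod_closed bf_pred.
Proof.
split; first by apply/mem_set; exact: bf_zero.
by move=> a f g /set_mem Xf /set_mem Xg; apply/mem_set; exact: bf_linear.
Qed.
HB.instance Definition _ :=
  GRing.isSubmodClosed.Build K (T -> E) bf_pred bf_submod_closed.
HB.instance Definition _ := [SubChoice_isSubLmodule of sup_normed by <:].

(* On an empty domain [sup set0 = 0] makes this the norm of the zero space. *)
Definition sup_norm (f : sup_normed) : K :=
  of_real s (sup [set rnorm (f t) | t in [set: T]]).

Lemma sup_normed_ub (f : sup_normed) :
  has_ubound [set rnorm (f t) | t in [set: T]].
Proof.
have [M [Mr fM]] := bf_bounded (set_mem (sup_normedP f)).
exists (re (M + 1)) => _ [t _ <-]; rewrite -(@ler_of_real R s) rnormE.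
rewrite of_realK ?realD ?real1//; apply: fM => //.
by rewrite ltrDl.
Qed.

Lemma ler_sup_norm (f : sup_normed) t :
  rnorm (f t) <= sup [set rnorm (f t) | t in [set: T]].
Proof. by apply: ub_le_sup; [exact: sup_normed_ub|exists t]. Qed.

Lemma sup_normD f g : sup_norm (f + g) <= sup_norm f + sup_norm g.
Proof.
rewrite /sup_norm -of_realD ler_of_real.
have [t0|T0] := pselect (exists t : T, True); last first.
  have E0 (h : T -> E) : [set rnorm (h t) | t in [set: T]] = set0.
    by rewrite -subset0 => x [t]; case: T0; exists t.
  by rewrite !E0 sup0 addr0.
apply: ge_sup; first by case: t0 => t _; exists (rnorm ((f + g) t)), t.
move=> _ [t _ <-]; rewrite (le_trans (ler_rnormD (f t) (g t)))//.
by rewrite lerD// ler_sup_norm.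
Qed.

Lemma sup_normZ (a : K) f : sup_norm (a *: f) = `|a| * sup_norm f.
Proof.
rewrite -(of_realK (normr_real a)) /sup_norm -of_realM; congr of_real.
have [t0|T0] := pselect (exists t : T, True); last first.
  have E0 (h : T -> E) : [set rnorm (h t) | t in [set: T]] = set0.
    by rewrite -subset0 => x [t]; case: T0; exists t.
  by rewrite !E0 sup0 mulr0.
have ne (h : T -> E) : [set rnorm (h t) | t in [set: T]] !=set0.
  by case: t0 => t _; exists (rnorm (h t)), t.
have a0 : 0 <= re `|a|.
  by rewrite -(@ler_of_real R s) of_real0 of_realK// normr_real.
apply/eqP; rewrite eq_le; apply/andP; split.
  apply: ge_sup => // _ [t _ <-].
  by rewrite (rnormZ a (f t)) ler_wpM2l// ler_sup_norm.
have [-> | an0] := eqVneq (re `|a|) 0.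
  rewrite mul0r; case: t0 => t _.
  exact: le_trans (rnorm_ge0 ((a *: f) t)) (ler_sup_norm _ _).
have {an0}a0 : 0 < re `|a| by rewrite lt_def an0.
rewrite mulrC -ler_pdivlMr//; apply: ge_sup => // _ [t _ <-].
by rewrite ler_pdivlMr// mulrC -(rnormZ a (f t)) (ler_sup_norm (a *: f)).
Qed.

Lemma sup_norm_eq0 f : sup_norm f = 0 -> f = 0.
Proof.
move=> f0; apply/val_inj/funext => t; apply: rnorm_eq0.
apply/eqP; rewrite eq_le rnorm_ge0 andbT.
move: f0; rewrite -(of_real0 R s) => /of_real_inj <-.
exact: ler_sup_norm.
Qed.

HB.instance Definition _ := @Lmodule_isNormed.Build K sup_normed
  sup_norm sup_normD sup_normZ sup_norm_eq0.

End function_spaces.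
Arguments bf_pred {R s T E} X.

Section quotient.
Context (R : realType) (s : scalars).
Local Notation K := (scalar_field R s).
Variable W : normedModType K.

Record closedSubspace := ClosedSubspace {
  subspace_set :> set W ;
  subspace_zero : subspace_set 0 ;
  subspace_linear : forall (a : K) x y, subspace_set x -> subspace_set y ->
    subspace_set (a *: x + y) ;
  subspace_closed : closed subspace_set }.

Variable Z : closedSubspace.
Local Notation Z_ := (subspace_set Z).
Local Open Scope quotient_scope.

Lemma subspaceD x y : Z_ x -> Z_ y -> Z_ (x + y).
Proof. by move=> Zx Zy; rewrite -[x]scale1r; exact: subspace_linear. Qed.

Lemma subspaceZ a x : Z_ x -> Z_ (a *: x).
Proof.
by move=> Zx; rewrite -[X in Z_ X]addr0; exact/subspace_linear/subspace_zero.
Qed.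

Lemma subspaceN x : Z_ x -> Z_ (- x).
Proof. by rewrite -scaleN1r; exact: subspaceZ. Qed.

Definition coset_rel (x y : W) : bool := `[< Z_ (x - y) >].

Lemma coset_rel_equiv : equiv_class_of coset_rel.
Proof.
split.
- by move=> x; apply/asboolP; rewrite subrr; exact: subspace_zero.
- by move=> x y; apply: asbool_equiv_eq; split=> /subspaceN; rewrite opprB.
- move=> y x z /asboolP xy /asboolP yz; apply/asboolP.
  by rewrite -(subrKA y); exact: subspaceD.
Qed.

Canonical coset_equivRel := EquivRelPack coset_rel_equiv.

Definition quotient : Type := {eq_quot coset_rel}.
HB.instance Definition _ := Choice.on quotient.
HB.instance Definition _ := EqQuotient.on quotient.

Definition quotient_map (x : W) : quotient := \pi_quotient x.

Lemma quotient_mapP x y : quotient_map x = quotient_map y <-> Z_ (x - y).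
Proof.
by split=> [/eqmodP/asboolP//|Zxy]; apply/eqmodP/asboolP.
Qed.

Lemma repr_quotient_map (u : quotient) : quotient_map (repr u) = u.
Proof. exact: reprK. Qed.

Definition quotient_add (u v : quotient) : quotient :=
  quotient_map (repr u + repr v).
Definition quotient_opp (u : quotient) : quotient := quotient_map (- repr u).
Definition quotient_scale (a : K) (u : quotient) : quotient :=
  quotient_map (a *: repr u).

Lemma repr_sub x : Z_ (repr (quotient_map x) - x).
Proof. by apply/quotient_mapP; rewrite repr_quotient_map. Qed.

Lemma quotient_mapD x y :
  quotient_map (x + y) = quotient_add (quotient_map x) (quotient_map y).
Proof.
apply/esym/quotient_mapP; rewrite opprD addrACA.
exact: subspaceD (repr_sub x) (repr_sub y).
Qed.

Lemma quotient_mapN x : quotient_map (- x) = quotient_opp (quotient_map x).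
Proof.
apply/esym/quotient_mapP; rewrite -opprD.
exact: subspaceN (repr_sub x).
Qed.

Lemma quotient_mapZ a x :
  quotient_map (a *: x) = quotient_scale a (quotient_map x).
Proof.
apply/esym/quotient_mapP; rewrite -scalerBr.
exact: subspaceZ (repr_sub x).
Qed.

Lemma quotient_ind (P : quotient -> Prop) :
  (forall x, P (quotient_map x)) -> forall u, P u.
Proof. by move=> Px u; rewrite -(repr_quotient_map u). Qed.

Lemma quotient_addA : associative quotient_add.
Proof.
elim/quotient_ind=> x; elim/quotient_ind=> y; elim/quotient_ind=> z.
by rewrite -!quotient_mapD addrA.
Qed.

Lemma quotient_addC : commutative quotient_add.
Proof.
by elim/quotient_ind=> x; elim/quotient_ind=> y; rewrite -!quotient_mapD addrC.
Qed.

Lemma quotient_add0 : left_id (quotient_map 0) quotient_add.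
Proof. by elim/quotient_ind=> x; rewrite -quotient_mapD add0r. Qed.

Lemma quotient_addN :
  left_inverse (quotient_map 0) quotient_opp quotient_add.
Proof.
by elim/quotient_ind=> x; rewrite -quotient_mapN -quotient_mapD addNr.
Qed.

HB.instance Definition _ := GRing.isZmodule.Build quotient
  quotient_addA quotient_addC quotient_add0 quotient_addN.

Lemma quotient_scaleA a b u :
  quotient_scale a (quotient_scale b u) = quotient_scale (a * b) u.
Proof. by elim/quotient_ind: u => x; rewrite -!quotient_mapZ scalerA. Qed.

Lemma quotient_scale1 : left_id 1 quotient_scale.
Proof. by elim/quotient_ind=> x; rewrite -quotient_mapZ scale1r. Qed.

Lemma quotient_scaleDr : right_distributive quotient_scale +%R.
Proof.
move=> a; elim/quotient_ind=> x; elim/quotient_ind=> y.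
rewrite -[quotient_map x + _]quotient_mapD -!quotient_mapZ.
by rewrite -[RHS]quotient_mapD scalerDr.
Qed.

Lemma quotient_scaleDl u : {morph quotient_scale^~ u : a b / a + b}.
Proof.
elim/quotient_ind: u => x a b /=.
by rewrite -!quotient_mapZ -[RHS]quotient_mapD scalerDl.
Qed.

HB.instance Definition _ := GRing.Zmodule_isLmodule.Build K quotient
  quotient_scaleA quotient_scale1 quotient_scaleDr quotient_scaleDl.

Lemma quotient_map_linear : linear quotient_map.
Proof. by move=> a x y; rewrite quotient_mapD quotient_mapZ. Qed.
HB.instance Definition _ :=
  GRing.isLinear.Build K W quotient *:%R quotient_map quotient_map_linear.

Definition quotient_norm (u : quotient) : K :=
  of_real s (inf [set rnorm x | x in quotient_map @^-1` [set u]]).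

Lemma quotient_norm_has_inf u :
  has_inf [set rnorm x | x in quotient_map @^-1` [set u]].
Proof.
split; last by exists 0 => _ [x _ <-]; exact: rnorm_ge0.
by exists (rnorm (repr u)), (repr u) => //; exact: repr_quotient_map.
Qed.


Lemma quotient_norm_le (u : quotient) x : quotient_map x = u ->
  quotient_norm u <= `|x|.
Proof.
move=> xu; rewrite -rnormE ler_of_real; apply: ge_inf; last by exists x.
by have [] := quotient_norm_has_inf u.
Qed.

Lemma quotient_norm_approx (u : quotient) (e : R) : 0 < e ->
  exists2 x, quotient_map x = u & `|x| < quotient_norm u + of_real s e.
Proof.
move=> e0; have [_ [x /= xu <-] xe] := inf_adherent e0 (quotient_norm_has_inf u).
exists x => //; rewrite -rnormE -of_realD lt_def ler_of_real (ltW xe) andbT.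
by apply: contraTneq xe => /of_real_inj ->; rewrite ltxx.
Qed.

Lemma quotient_normD u v :
  quotient_norm (u + v) <= quotient_norm u + quotient_norm v.
Proof.
rewrite -of_realD ler_of_real; apply/ler_addgt0Pr => e e0.
have e20 : 0 < e / 2 by rewrite divr_gt0.
have [_ [x /= xu <-] xe] := inf_adherent e20 (quotient_norm_has_inf u).
have [_ [y /= yv <-] ye] := inf_adherent e20 (quotient_norm_has_inf v).
apply: (@le_trans _ _ (rnorm (x + y))).
  apply: ge_inf; first by have [] := quotient_norm_has_inf (u + v).
  by exists (x + y) => //=; rewrite quotient_mapD xu yv.
rewrite (le_trans (ler_rnormD x y))// [e]splitr addrACA.
by rewrite lerD// ltW.
Qed.

Lemma quotient_normZ_le (a : K) u :
  quotient_norm (a *: u) <= `|a| * quotient_norm u.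
Proof.
have a0 : 0 <= re `|a|.
  by rewrite -(@ler_of_real R s) of_real0 of_realK// normr_real.
rewrite -(of_realK (normr_real a)) -of_realM ler_of_real.
have [ra|an0] := eqVneq (re `|a|) 0.
  have -> : a = 0.
    by apply/normr0_eq0; rewrite -(of_realK (normr_real a)) ra of_real0.
  rewrite scale0r normr0 -(of_real0 R s) re_of_real mul0r.
  apply: ge_inf; first by have [] := quotient_norm_has_inf 0.
  by exists 0; [|exact: rnorm0].
have {}a0 : 0 < re `|a| by rewrite lt_def an0.
rewrite mulrC -ler_pdivrMr//; apply: lb_le_inf.
  by have [] := quotient_norm_has_inf u.
move=> _ [x /= xu <-]; rewrite ler_pdivrMr// mulrC -rnormZ.
apply: ge_inf; first by have [] := quotient_norm_has_inf (a *: u).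
by exists (a *: x) => //=; rewrite quotient_mapZ xu.
Qed.

Lemma quotient_normZ (a : K) u : quotient_norm (a *: u) = `|a| * quotient_norm u.
Proof.
apply/eqP; rewrite eq_le quotient_normZ_le/=.
have [->|a0] := eqVneq a 0.
  rewrite normr0 mul0r scale0r /quotient_norm -(of_real0 R s) ler_of_real.
  apply: lb_le_inf; first by have [] := quotient_norm_has_inf 0.
  by move=> _ [x _ <-]; exact: rnorm_ge0.
rewrite mulrC -ler_pdivlMr ?normr_gt0// mulrC -normfV.
by rewrite -[X in quotient_norm X <= _](scalerK a0) quotient_normZ_le.
Qed.

Lemma quotient_norm_eq0 (u : quotient) : quotient_norm u = 0 -> u = 0.
Proof.
elim/quotient_ind: u => x x0; apply/quotient_mapP; rewrite subr0.
apply: subspace_closed => B /nbhs_normP[e /= e0 eB].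
have e0' : of_real s (re e) = e by rewrite of_realK// gtr0_real.
have re0 : 0 < re e.
  rewrite lt_def -(@ler_of_real R s) of_real0 e0' (ltW e0) andbT.
  by apply: contraTneq e0 => ee; rewrite -e0' ee of_real0 ltxx.
have [y /quotient_mapP yx] := quotient_norm_approx (quotient_map x) re0.
rewrite x0 add0r e0' => ye; exists (x - y); split.
  by rewrite -opprB; exact: subspaceN.
by apply: eB; rewrite /ball_/= opprB addrC subrK.
Qed.

HB.instance Definition _ := @Lmodule_isNormed.Build K quotient
  quotient_norm quotient_normD quotient_normZ quotient_norm_eq0.

End quotient.

Section rich_subspaces.
Context (R : realType) (s : scalars).
Local Notation K := (scalar_field R s).
Implicit Types W V : normedModType K.

Definition slice W (S : set W) : Prop :=
  S !=set0 /\
  exists (w' : {linear W -> K^o}) (alpha : R), continuous w' /\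
    S = [set w | `|w| <= 1 /\ alpha < re (w' w)].

(* "Operator" means bounded linear operator. Completeness of [W] and [V] plays
   no role in the definition, so it is stated for normed spaces. *)
Definition narrow W V (T : {linear W -> V}) : Prop :=
  continuous T /\
  forall (x y : W) (e : R) (S : set W),
    `|x| = 1 -> `|y| = 1 -> 0 < e -> slice S -> S y ->
    exists v : W, [/\ S v, 2 - of_real s e < `|x + v| &
                     `|T (y - v)| < of_real s e].

Definition rich W (Z : closedSubspace W) : Prop :=
  narrow (quotient_map Z : {linear W -> quotient Z}).

Definition separable W (A : set W) : Prop :=
  exists B : set W, [/\ countable B, B `<=` A & A `<=` closure B].

End rich_subspaces.

Section bounded_combination.
Context (R : realType) (s : scalars) (T : Type).
Local Notation K := (scalar_field R s).
Variable E : normedModType K.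

Lemma bounded_fun0 : bounded_fun (fun _ : T => 0 : E).
Proof.
by exists 0; split; [exact: real0|move=> x x0 t _; rewrite normr0 ltW].
Qed.

Lemma bounded_fun_linear (a : K) (f g : T -> E) :
  bounded_fun f -> bounded_fun g -> bounded_fun (fun t => a *: f t + g t).
Proof.
move=> [M [Mr fM]] [N [Nr gN]].
have Mr1 : M + 1 \is Num.real by rewrite realD ?real1.
have Nr1 : N + 1 \is Num.real by rewrite realD ?real1.
exists (`|a| * (M + 1) + (N + 1)); split; first by rewrite realD ?realM ?normr_real.
move=> x /ltW xM t _ /=; apply: le_trans xM.
rewrite (le_trans (ler_normD _ _))// lerD//; last by apply: gN => //; rewrite ltrDl.
by rewrite normrZ ler_wpM2l//; apply: fM => //; rewrite ltrDl.
Qed.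

End bounded_combination.

Section continuous_functions.
Context (R : realType) (s : scalars) (T : topologicalType).
Local Notation K := (scalar_field R s).
Variable E : normedModType K.

Definition weakly_continuous (f : T -> E) : Prop :=
  forall phi : {linear E -> K^o}, continuous phi -> continuous (phi \o f).

(* The sup-norm is only defined on bounded functions. On a compact [T] the second
   condition is redundant: a weakly continuous function is weakly bounded, hence
   bounded by the uniform boundedness principle. *)
Definition Cw_carrier : set (T -> E) :=
  [set f | weakly_continuous f] `&` bounded_fun.

Lemma Cw_zero : Cw_carrier (fun=> 0).
Proof.
split; last exact: bounded_fun0.
by move=> phi _ t; exact: cvg_cst.
Qed.

Lemma Cw_linear (a : K) f g : Cw_carrier f -> Cw_carrier g ->
  Cw_carrier (fun t => a *: f t + g t).
Proof.
move=> [wf bf] [wg bg]; split; last exact: bounded_fun_linear.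
move=> phi cphi; rewrite [_ \o _](_ : _ = fun t => a *: phi (f t) + phi (g t)).
  by move=> t; apply: cvgD; [apply: cvgZr; exact: wf|exact: wg].
by apply/funext => t /=; rewrite linearP.
Qed.

Definition Cw : boundedFunctions T E :=
  BoundedFunctions Cw_zero Cw_linear (@subIsetr _ _ _).

(* The norm-continuous members of [X]. For the spaces [X] below this is all of
   C(T, E): see [continuous_Cw] and [continuous_cadlag]. *)
Variable X : boundedFunctions T E.

Definition continuous_part : set (sup_normed X) :=
  [set f | continuous (f : T -> E)].

Lemma continuous_part_linear (a : K) (f g : sup_normed X) :
  continuous_part f -> continuous_part g -> continuous_part (a *: f + g).
Proof. by move=> cf cg t; apply: cvgD; [apply: cvgZr; exact: cf|exact: cg]. Qed.

Lemma continuous_part_closed : closed continuous_part.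
Proof.
move=> f clf t; apply/cvgrPdist_lt => e e0.
have e30 : 0 < e / 3%:R by rewrite divr_gt0.
have [g [cg]] := clf _ (nbhsx_ballx f _ e30).
rewrite -ball_normE /= => fg.
have fgu u : `|f u - g u| < e / 3%:R.
  apply: le_lt_trans fg; rewrite -rnormE ler_of_real.
  exact: (ler_sup_norm (f - g) u).
have /cvgrPdist_lt/(_ _ e30) := cg t; apply: filterS => u gtu.
rewrite -(subrK (g t) (f t)) -addrA -(subrK (g u) (g t - f u)) addrA.
have -> : e = e / 3%:R + (e / 3%:R + e / 3%:R).
  by rewrite -!mulrDl -mulr2n -mulrS -[X in X / _]mulr_natr mulfK// pnatr_eq0.
rewrite -addrA (le_lt_trans (ler_normD _ _))// ltrD//.
have -> : g t - f u - g u + g u = (g t - g u) + (g u - f u).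
  by rewrite subrK addrA subrK.
rewrite (le_lt_trans (ler_normD _ _))// ltrD//.
by rewrite distrC.
Qed.

Lemma continuous_part_zero : continuous_part 0.
Proof. by move=> t; exact: cvg_cst. Qed.

Definition C_sub : closedSubspace (sup_normed X) := ClosedSubspace
  continuous_part_zero continuous_part_linear continuous_part_closed.

Lemma compact_continuous_bounded (f : T -> E) :
  compact [set: T] -> continuous f -> bounded_fun f.
Proof.
move=> cT cf.
have cn : continuous (fun t => rnorm (f t)).
  move=> t; apply/cvgrPdist_lt => e e0.
  have e0' : 0 < of_real s e by rewrite -(of_real0 R s) ltr_of_real.
  have /cvgrPdist_lt/(_ _ e0') := cf t; apply: filterS => u.
  by rewrite -rnormE ltr_of_real; apply: le_lt_trans (ler_rnormB_dist _ _).
have : compact [set rnorm (f t) | t in [set: T]].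
  by apply: continuous_compact cT; exact: continuous_subspaceT.
move=> /compact_bounded [M [Mr fM]].
exists (of_real s (M + 1)); split.
  case: (lerP 0 (M + 1)) => M0; [apply: ger0_real|apply: ltr0_real];
  by rewrite -(of_real0 R s) ?ler_of_real ?ltr_of_real.
move=> x Mx t _; apply: le_trans (ltW Mx); rewrite -rnormE ler_of_real.
rewrite -[leLHS]ger0_norm ?rnorm_ge0//; apply: fM; last by exists t.
by rewrite ltrDl.
Qed.

Lemma continuous_Cw (f : T -> E) :
  compact [set: T] -> continuous f -> Cw_carrier f.
Proof.
move=> cT cf; split; last exact: compact_continuous_bounded.
by move=> phi cphi t; apply: continuous_comp; [exact: cf|exact: cphi].
Qed.

End continuous_functions.

Section unit_interval.
Context (R : realType) (s : scalars).
Local Notation K := (scalar_field R s).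

Definition I01 : Type := set_type `[0 : R, 1]%classic.
HB.instance Definition _ :=
  PseudoMetric.copy I01 (set_type `[0 : R, 1]%classic).
Definition I01_val (t : I01) : R := sval t.

(* The filter of right (resp. left) neighbourhoods is improper at the right
   (resp. left) endpoint, so that the second (resp. third) clause holds trivially
   there. *)
Definition cadlag (f : I01 -> K^o) : Prop :=
  [/\ bounded_fun f,
      forall t, f @ within [set u | I01_val t < I01_val u] (nbhs t) --> f t,
      forall t, exists l : K^o,
        f @ within [set u | I01_val u < I01_val t] (nbhs t) --> l &
      forall t, I01_val t = 1 -> {for t, continuous f}].

Lemma cadlag_zero : cadlag (fun=> 0).
Proof.
split; [exact: bounded_fun0|move=> t; exact: cvg_cst| |].
- by move=> t; exists 0; exact: cvg_cst.
- by move=> t _; exact: cst_continuous.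
Qed.

Lemma cadlag_linear (a : K) (f g : I01 -> K^o) : cadlag f -> cadlag g ->
  cadlag (fun t => a *: f t + g t).
Proof.
move=> [bf rf lf cf] [bg rg lg cg]; split; first exact: bounded_fun_linear.
- by move=> t; apply: cvgD; [apply: cvgZr; exact: rf|exact: rg].
- move=> t; have [l fl] := lf t; have [m gm] := lg t.
  by exists (a *: l + m); apply: cvgD; [exact: cvgZr|].
- move=> t t1; have ft := cf t t1; have gt := cg t t1.
  exact: (continuousD (continuousZr ft) gt).
Qed.

Lemma cadlag_bounded : cadlag `<=` bounded_fun.
Proof. by move=> f []. Qed.

Definition D01 : boundedFunctions I01 K^o :=
  BoundedFunctions cadlag_zero cadlag_linear cadlag_bounded.

Lemma compact_I01 : compact [set: I01].
Proof.
pose c (x : R) : R := Num.max 0 (Num.min x 1).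
have c01 x : c x \in `[0 : R, 1]%classic.
  by rewrite inE/= in_itv/= le_max lexx ge_max ler01 ge_min lexx orbT.
pose p (x : R) : I01 := exist _ (c x) (c01 x).
have cc : continuous c.
  move=> x; apply: (@continuous_max R R (cst 0) (fun y => Num.min y 1)).
    exact: cst_continuous.
  apply: (@continuous_min R R id (cst 1)); first exact: cvg_id.
  exact: cst_continuous.
have cp : continuous p by apply: continuous_comp_initial.
rewrite (_ : [set: I01] = p @` `[0 : R, 1]); last first.
  apply/seteqP; split => // -[x x01] _; exists x; first exact: set_mem.
  apply/val_inj => /=; move: x01; rewrite inE/= in_itv/= => /andP[x0 x1].
  by rewrite /c (min_idPl x1) (max_idPr x0).
by apply: continuous_compact (@segment_compact R 0 1); exact: continuous_subspaceT.
Qed.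

Lemma continuous_cadlag (f : I01 -> K^o) : continuous f -> cadlag f.
Proof.
move=> cf; split.
- exact: compact_continuous_bounded compact_I01 cf.
- by move=> t; apply: cvg_within_filter; exact: cf.
- by move=> t; exists (f t); apply: cvg_within_filter; exact: cf.
- by move=> t _; exact: cf.
Qed.

End unit_interval.

Section lp.
Context (R : realType) (s : scalars) (p : R).
Local Notation K := (scalar_field R s).

Definition lp_Lnorm (x : nat -> K^o) : \bar R :=
  'N[counting]_p%:E [EFin \o (fun n => rnorm (x n))]%E.

(* The proof of [1 <= p] is an argument of the type [lp], so that its normed
   structure can be inferred. *)
Definition lp_pred (p1 : 1 <= p) : {pred nat -> K^o} :=
  mem [set x | (lp_Lnorm x < +oo)%E].

Variable p1 : 1 <= p.

Record lp := Lp { lp_seq :> nat -> K^o ; lpP : lp_seq \in lp_pred p1 }.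

HB.instance Definition _ := [isSub for lp_seq].
HB.instance Definition _ := [Choice of lp by <:].

Let p0 : 0 < p. Proof. exact: lt_le_trans ltr01 p1. Qed.

Let re_ge0 (a : K) : 0 <= re `|a|. Proof. exact: (@rnorm_ge0 R s K^o). Qed.

Let Lnorm_sum (f : nat -> R) : (forall n, 0 <= f n) ->
  ('N[counting]_p%:E [EFin \o f] = (\sum_(0 <= k <oo) (f k `^ p)%:E) `^ p^-1)%E.
Proof.
move=> f0; rewrite Lnorm_counting//; congr (_ `^ _)%E.
apply: eq_eseriesr => k _. by rewrite /= ger0_norm.
Qed.

Let le_Lnorm (f g : nat -> R) : (forall n, 0 <= f n <= g n) ->
  ('N[counting]_p%:E [EFin \o f] <= 'N[counting]_p%:E [EFin \o g])%E.
Proof.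
move=> fg; have f0 n : 0 <= f n by case/andP: (fg n).
have g0 n : 0 <= g n by case/andP: (fg n) => fn gn; exact: le_trans gn.
have ge0 (h : nat -> R) : (0 <= \sum_(0 <= k <oo) (h k `^ p)%:E)%E.
  by apply: nneseries_ge0 => n _ _; rewrite lee_fin powR_ge0.
rewrite !Lnorm_sum//; apply: gt0_ler_poweR.
- by rewrite invr_ge0 ltW.
- by rewrite in_itv/= leey ge0.
- by rewrite in_itv/= leey ge0.
apply: lee_nneseries => [n _ _|n _]; first by rewrite lee_fin powR_ge0.
by rewrite lee_fin ge0_ler_powR// ?nnegrE// ?(ltW p0)//; case/andP: (fg n).
Qed.

Lemma lp_LnormD (x y : nat -> K^o) :
  (lp_Lnorm (x + y)%R <= lp_Lnorm x + lp_Lnorm y)%E.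
Proof.
apply: le_trans (minkowski_EFin counting _ _ p1) => //; apply: le_Lnorm => n.
by rewrite rnorm_ge0/= ler_rnormD.
Qed.

Lemma lp_LnormZ (a : K) (x : nat -> K^o) :
  lp_Lnorm (a *: x) = ((re `|a|)%:E * lp_Lnorm x)%E.
Proof.
rewrite /lp_Lnorm !Lnorm_sum//; try by move=> n; exact: rnorm_ge0.
have ax k : rnorm ((a *: x) k) = re `|a| * rnorm (x k) by exact: rnormZ.
under eq_eseriesr => k _ do rewrite ax powRM ?rnorm_ge0// EFinM.
rewrite nneseriesZl; last by move=> k _; rewrite lee_fin powR_ge0.
rewrite poweRM ?lee_fin ?powR_ge0//; last first.
  by apply: nneseries_ge0 => n _ _; rewrite lee_fin powR_ge0.
by rewrite poweR_EFin -powRrM mulfV ?gt_eqF// powRr1.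
Qed.

Lemma lp_Lnorm_eq0 (x : nat -> K^o) : lp_Lnorm x = 0 -> x = 0.
Proof.
rewrite /lp_Lnorm Lnorm_sum; last by move=> n; exact: rnorm_ge0.
move=> /poweR_eq0_eq0 x0; apply/funext => n.
have {}x0 : (\sum_(0 <= k <oo) (rnorm (x k) `^ p)%:E = 0)%E.
  by apply: x0; apply: nneseries_ge0 => k _ _; rewrite lee_fin powR_ge0.
have : (\sum_(0 <= k < n.+1) (rnorm (x k) `^ p)%:E <= 0)%E.
  rewrite -[leRHS]x0; apply: nneseries_lim_ge => k _ _.
  by rewrite lee_fin powR_ge0.
rewrite sumEFin lee_fin big_nat_recr//= => xn.
apply: rnorm_eq0; apply: (@powR_eq0_eq0 _ _ p).
apply/eqP; rewrite eq_le powR_ge0 andbT; apply: le_trans xn.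
by rewrite lerDr sumr_ge0// => k _; exact: powR_ge0.
Qed.

Lemma lp_submod_closed : submod_closed (lp_pred p1).
Proof.
split.
  rewrite inE/= -[X in lp_Lnorm X](scale0r 0) lp_LnormZ normr0.
  by rewrite -(of_real0 R s) re_of_real mul0e ltry.
move=> a x y; rewrite !inE/= => xf yf.
rewrite (le_lt_trans (lp_LnormD _ _))// lp_LnormZ lte_add_pinfty//.
by rewrite lte_mul_pinfty// lee_fin.
Qed.
HB.instance Definition _ :=
  GRing.isSubmodClosed.Build K (nat -> K^o) (lp_pred p1) lp_submod_closed.
HB.instance Definition _ := [SubChoice_isSubLmodule of lp by <:].

Definition lp_norm (x : lp) : K := of_real s (fine (lp_Lnorm x)).

Let lp_fin (x : lp) : lp_Lnorm x \is a fin_num.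
Proof.
rewrite ge0_fin_numE; first by have := lpP x; rewrite inE.
exact: Lnorm_ge0.
Qed.

Lemma lp_normD x y : lp_norm (x + y) <= lp_norm x + lp_norm y.
Proof.
rewrite -of_realD ler_of_real -fineD// fine_le// ?fin_numD ?lp_fin//.
exact: lp_LnormD.
Qed.

Lemma lp_normZ (a : K) x : lp_norm (a *: x) = `|a| * lp_norm x.
Proof.
rewrite -(of_realK (normr_real a)) -of_realM; congr of_real.
by rewrite lp_LnormZ fineM.
Qed.

Lemma lp_norm_eq0 x : lp_norm x = 0 -> x = 0.
Proof.
rewrite -(of_real0 R s) => /of_real_inj x0; apply/val_inj/lp_Lnorm_eq0.
by rewrite -(fineK (lp_fin x)) x0.
Qed.

HB.instance Definition _ :=
  @Lmodule_isNormed.Build K lp lp_norm lp_normD lp_normZ lp_norm_eq0.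

End lp.

(* Main.v *)
(** Let [x, y] be in the unit sphere of one of the function spaces at hand. The
    point is to find a nonempty open set [V] on which [|x| > 1 - d] and [y] stays
    within [d] of a single vector [c]. For cadlag functions this follows from
    one-sided continuity; for a weakly continuous function it is Namioka's theorem
    that such a function has small norm oscillation on some open subset of every
    open set. Since the domain is perfect, [V] contains disjoint open sets with
    points [t n] and bumps [h n] peaking there, and
    [y + h n * (x (t n) - c)] has norm at most [1 + d] and almost agrees with [x]
    at [t n]. The corrections [h n * (x (t n) - c)] are continuous, and disjointness
    of supports bounds their partial sums, so that any given functional is almost
    nonnegative on some of them: hence the perturbed function stays in a given slice.

    Continuous functions into a separable space are approximated by
    piecewise-linear ones. [D01] contains the jumps at the points of [0, 1/2];
    in [Cw I01 lp] the functions [\sum_(k in A) hat k.+1 (1 / t) *: e k], for sets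
    [A] of naturals, are at distance at least 1 from each other, and they are
    weakly continuous at 0 because the unit vectors [e k] are weakly null for
    [1 < p]. *)

Require Import Defs.
From HB Require Import structures.
From mathcomp Require Import all_boot all_order all_algebra.
From mathcomp Require Import complex.
From mathcomp Require Import all_classical all_reals all_analysis.
From mathcomp Require Import ring lra zify.

Set Implicit Arguments.
Unset Strict Implicit.
Unset Printing Implicit Defensive.

Import Order.TTheory GRing.Theory Num.Theory.
Import numFieldNormedType.Exports.

Local Open Scope classical_set_scope.
Local Open Scope ring_scope.

(** * Scalars and real-valued norms *)

Section real_part.
Context (R : realType) (s : scalars).
Local Notation K := (scalar_field R s).
Implicit Types (a b : K) (r : R).

Lemma reD a b : re (a + b) = re a + re b.
Proof. by case: s a b => //= -[? ?] [? ?]. Qed.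

Lemma reN a : re (- a) = - re a.
Proof. by case: s a => //= -[? ?]. Qed.

Lemma reB a b : re (a - b) = re a - re b.
Proof. by rewrite reD reN. Qed.

Lemma re_norm_ge0 a : 0 <= re `|a|.
Proof. exact: (@rnorm_ge0 R s K^o). Qed.

Lemma re_le_norm a : re a <= re `|a|.
Proof.
case: s a => [a|a] /=; first exact: ler_norm.
rewrite -lecR (RRe_real (normr_real a)); apply: le_trans (normc_ge_Re a).
by rewrite lecR ler_norm.
Qed.

Lemma of_real1 : of_real s 1 = 1 :> K.
Proof. by case: s. Qed.

Lemma of_realN r : of_real s (- r) = - of_real s r.
Proof. by apply/eqP; rewrite -subr_eq0 opprK -of_realD addNr of_real0. Qed.

Lemma norm_of_real r : re `|of_real s r| = `|r|.
Proof.
have [r0|r0] := ger0P r.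
  by rewrite ger0_norm ?re_of_real// -(of_real0 R s) ler_of_real.
by rewrite ltr0_norm ?reN ?re_of_real// -(of_real0 R s) ltr_of_real.
Qed.

Lemma of_real_gt0 r : (0 < of_real s r :> K) = (0 < r).
Proof. by rewrite -{1}(of_real0 R s) ltr_of_real. Qed.

Lemma of_real_gt0_ex a : 0 < a -> exists2 r : R, a = of_real s r & 0 < r.
Proof.
by move=> a0; exists (re a); rewrite -?of_real_gt0 of_realK ?gtr0_real.
Qed.

Lemma normr_rnorm (V : normedModType K) (x : V) r :
  ((`|x| < of_real s r) = (rnorm x < r)) * ((`|x| <= of_real s r) = (rnorm x <= r)).
Proof. by rewrite -rnormE ltr_of_real ler_of_real. Qed.

Lemma rnormB_sym (V : normedModType K) (x y : V) : rnorm (x - y) = rnorm (y - x).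
Proof. by rewrite -rnormN opprB. Qed.

Lemma ler_rnormB (V : normedModType K) (x y : V) :
  rnorm (x - y) <= rnorm x + rnorm y.
Proof. by rewrite -(rnormN y) ler_rnormD. Qed.

Lemma rnorm_tri (V : normedModType K) (z x y : V) :
  rnorm (x - y) <= rnorm (x - z) + rnorm (z - y).
Proof. by rewrite -(subrKA z x) ler_rnormD. Qed.

Lemma rnormZr (V : normedModType K) r (x : V) :
  rnorm (of_real s r *: x) = `|r| * rnorm x.
Proof. by rewrite rnormZ norm_of_real. Qed.

Lemma rnorm_gt0 (V : normedModType K) (x : V) : (0 < rnorm x) = (x != 0).
Proof.
rewrite lt_def rnorm_ge0 andbT; congr negb; apply/eqP/eqP => [/rnorm_eq0//|->].
exact: rnorm0.
Qed.

Lemma cvg_rnormP (V : normedModType K) (T : Type) (F : set_system T)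
    (f : T -> V) (l : V) : Filter F ->
  f @ F --> l <-> forall e : R, 0 < e -> \forall t \near F, rnorm (l - f t) < e.
Proof.
move=> FF; split => [/cvgrPdist_lt fl e e0|fl].
  have := fl (of_real s e); rewrite of_real_gt0 => /(_ e0).
  by apply: filterS => t; rewrite normr_rnorm.
apply/cvgrPdist_lt => _ /of_real_gt0_ex [e -> e0].
by have := fl _ e0; apply: filterS => t; rewrite normr_rnorm.
Qed.

Lemma continuous_rnormP (V : normedModType K) (T : topologicalType)
    (f : T -> V) (t : T) : {for t, continuous f} <->
  forall e : R, 0 < e -> \forall u \near t, rnorm (f t - f u) < e.
Proof. exact: (@cvg_rnormP V T (nbhs t) f (f t) _). Qed.

Lemma closure_rnormP (V : normedModType K) (A : set V) (x : V) :
  closure A x <-> forall e : R, 0 < e -> exists2 y, A y & rnorm (x - y) < e.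
Proof.
split=> [clA e e0|clA U /nbhs_ballP [_ /of_real_gt0_ex [e -> e0] eU]].
  have e0' : 0 < of_real s e by rewrite of_real_gt0.
  have [y [Ay]] := clA _ (nbhsx_ballx x _ e0').
  by rewrite -ball_normE /= normr_rnorm => ?; exists y.
have [y Ay xy] := clA _ e0; exists y; split => //; apply: eU.
by rewrite -ball_normE /= normr_rnorm.
Qed.

Lemma linear_continuous_bound (V W : normedModType K) (f : {linear V -> W}) :
  continuous f -> exists2 M : R, 0 < M & forall x, rnorm (f x) <= M * rnorm x.
Proof.
move=> /linear_bounded_continuous/linear_boundedP/pinfty_ex_gt0 [_ /of_real_gt0_ex [M -> M0] fM].
exists M => // x; have := fM x.
by rewrite -rnormE -[`|x|]rnormE -of_realM ler_of_real.
Qed.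

Lemma bounded_linear_continuousr (V W : normedModType K) (f : {linear V -> W}) M :
  (forall x, rnorm (f x) <= M * rnorm x) -> continuous f.
Proof.
move=> fM x; apply/continuous_rnormP => e e0.
have d0 : 0 < e / (`|M| + 1) by rewrite divr_gt0// ltr_wpDl.
have /continuous_rnormP/(_ _ d0) : {for x, continuous (fun y : V => y)} by exact: cvg_id.
apply: filterS => y; rewrite ltr_pdivlMr ?ltr_wpDl// mulrC.
apply: le_lt_trans; rewrite -linearB; apply: (le_trans (fM _)).
by rewrite ler_wpM2r ?rnorm_ge0// (le_trans (ler_norm M))// lerDl.
Qed.

End real_part.

(** * The Hahn-Banach theorem *)

Section hahn_banach.
Context (R : realType) (s : scalars).
Local Notation K := (scalar_field R s).
Variable V : normedModType K.
Local Notation "r %*: v" := (of_real s r *: v) (at level 40).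

(* Graphs of partial real-linear functionals dominated by the norm; the empty
   graph is allowed so that unions of chains stay in the family. *)
Definition dominated_graph (x : V) (G : set (V * R)) : Prop :=
  [/\ forall r v a w b, G (v, a) -> G (w, b) -> G (r %*: v + w, r * a + b),
      forall v a, G (v, a) -> a <= rnorm v &
      G !=set0 -> G (x, rnorm x)].

(** One-dimensional extension step. A value [c] at [v0] preserves domination as soon as [b - rnorm
    (w - v0) <= c <= rnorm (w + v0) - b] on [G]. By the triangle inequality every lower bound is
    below every upper one, so the supremum of the lower bounds works. If [G] already contains
    [(v0, a)], these bounds force [c = a]. *)
Lemma dominated_graph_extend (x : V) (G : set (V * R)) (v0 : V) :
  dominated_graph x G -> G (x, rnorm x) ->
  exists2 H, dominated_graph x H & G `<=` H /\ exists c, H (v0, c).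
Proof.
move=> [Gl Gb _] Gx.
have G0 : G (0, 0).
  have := Gl (-1) _ _ _ _ Gx Gx.
  by rewrite of_realN of_real1 scaleN1r mulN1r !addNr.
have GZ r v a : G (v, a) -> G (r %*: v, r * a).
  by move=> Gv; have := Gl r _ _ _ _ Gv G0; rewrite !addr0.
pose A := [set z | exists2 w, G w & z = w.2 - rnorm (w.1 - v0)].
have ubA w b : G (w, b) -> ubound A (rnorm (w + v0) - b).
  move=> Gw _ [[v a] Gv ->] /=; rewrite lerBlDr addrAC lerBrDr.
  have := Gl 1 _ _ _ _ Gv Gw; rewrite of_real1 scale1r mul1r => /Gb /le_trans.
  apply; rewrite addrC; have := ler_rnormD (v - v0) (w + v0).
  by rewrite addrACA addNr addr0 addrC.
have A0 : A !=set0 by exists (0 - rnorm (0 - v0)), (0, 0).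
have supA : has_sup A by split=> //; exists (rnorm (0 + v0) - 0); exact: ubA.
pose c := sup A.
have c_ge w b : G (w, b) -> b - rnorm (w - v0) <= c.
  by move=> Gw; apply: ub_le_sup; [case: supA|exists (w, b)].
have c_le w b : G (w, b) -> c <= rnorm (w + v0) - b.
  by move=> Gw; apply: ge_sup => //; exact: ubA.
exists [set z | exists r w, G w /\ z = (r %*: v0 + w.1, r * c + w.2)]; last first.
  split; last by exists c, 1, (0, 0); split => //=; rewrite of_real1 scale1r mul1r !addr0.
  move=> [v a] Gv; exists 0, (v, a); split => //=.
  by rewrite of_real0 scale0r mul0r !add0r.
split.
- move=> r _ _ _ _ [r1 [[v a] [Gv [-> ->]]]] [r2 [[w b] [Gw [-> ->]]]] /=.
  exists (r * r1 + r2), (r %*: v + w, r * a + b); split; first exact: Gl.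
  congr (_, _) => /=; last by ring.
  by rewrite of_realD of_realM scalerDl scalerDr scalerA addrACA.
- move=> _ _ [r [[w b] [Gw [-> ->]]]] /=.
  have [r0|r0|->] := ltrgt0P r.
  + have := c_le _ _ (GZ r^-1 _ _ Gw).
    rewrite -(ler_pM2l r0) mulrBr mulrA divff ?gt_eqF// mul1r => h.
    apply: (@le_trans _ _ (r * rnorm (r^-1 %*: w + v0))); first by rewrite -lerBrDr.
    rewrite -{1}(gtr0_norm r0) -rnormZr scalerDr scalerA -of_realM divff ?gt_eqF//.
    by rewrite of_real1 scale1r addrC.
  + have q0 : 0 < - r by rewrite oppr_gt0.
    have := c_ge _ _ (GZ (- r)^-1 _ _ Gw).
    rewrite -(ler_pM2l q0) mulrBr mulrA divff ?gt_eqF// mul1r => h.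
    apply: (@le_trans _ _ (- r * rnorm ((- r)^-1 %*: w - v0))).
      by rewrite addrC -lerBrDr -mulNr; move: h; rewrite lerBlDr addrC -lerBlDr.
    rewrite -{1}(gtr0_norm q0) -rnormZr scalerBr scalerA -of_realM divff ?gt_eqF//.
    by rewrite of_real1 scale1r of_realN scaleNr opprK addrC.
  + by rewrite mul0r of_real0 scale0r !add0r; exact: Gb.
- move=> _; exists 0, (x, rnorm x); split => //=.
  by rewrite of_real0 scale0r mul0r !add0r.
Qed.

Lemma real_hahn_banach (x : V) : exists f : V -> R,
  [/\ forall r v w, f (r %*: v + w) = r * f v + f w,
      forall v, f v <= rnorm v & f x = rnorm x].
Proof.
have [|G [PG maxG]] := @Zorn_bigcup _ (dominated_graph x).
  move=> F FP totF; split.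
  - move=> r v a w b [X FX Xv] [Y FY Yw].
    have [XY|YX] := totF _ _ FX FY.
      by exists Y => //; have [+ _ _] := FP _ FY; apply => //; exact: XY.
    by exists X => //; have [+ _ _] := FP _ FX; apply => //; exact: YX.
  - by move=> v a [X FX Xv]; have [_ + _] := FP _ FX; apply.
  - move=> [z [X FX Xz]]; exists X => //.
    by have [_ _] := FP _ FX; apply; exists z.
(* The maximal graph could only miss this pair by being empty, and then the line [L] through [x]
   would extend it properly. *)
have Gx : G (x, rnorm x).
  have [nG0|G0] := pselect (G !=set0); first by have [_ _] := PG; apply.
  pose L := [set (r %*: x, r * rnorm x) | r in [set: R]].
  have Lx : L (x, rnorm x) by exists 1 => //; rewrite of_real1 scale1r mul1r.
  have GL : G `<=` L by move=> z Gz; case: G0; exists z.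
  have [LG|nLG] := pselect (L `<=` G); first exact: LG.
  exfalso; apply: (maxG L) => //; split.
  - move=> r _ _ _ _ [p _ [<- <-]] [q _ [<- <-]]; exists (r * p + q) => //.
    by rewrite of_realD of_realM scalerDl scalerA mulrDl mulrA.
  - by move=> _ _ [p _ [<- <-]]; rewrite rnormZr ler_wpM2r ?rnorm_ge0 ?ler_norm.
  - by [].
have tot v : exists a, G (v, a).
  have [H PH [GH [c Hc]]] := dominated_graph_extend v PG Gx.
  have [HG|nHG] := pselect (H `<=` G); first by exists c; exact: HG.
  by exfalso; apply: (maxG H).
have [f fG] := choice tot.
have [Gl Gb _] := PG.
(* Domination makes the graph single-valued: both [b - a] and [a - b] are values at 0, hence at most
   0. *)
have uniq v a b : G (v, a) -> G (v, b) -> a = b.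
  move=> Ga Gb'; apply/eqP; rewrite eq_le -(subr_le0 b a) -(subr_le0 a b).
  have := Gb _ _ (Gl (-1) _ _ _ _ Ga Gb'); have := Gb _ _ (Gl (-1) _ _ _ _ Gb' Ga).
  by rewrite of_realN of_real1 scaleN1r !mulN1r addNr rnorm0 !(addrC (- _)) => -> ->.
exists f; split.
- by move=> r v w; apply: (uniq (r %*: v + w)) => //; exact: Gl.
- by move=> v; exact: Gb (fG v).
- exact: (uniq x).
Qed.

End hahn_banach.

(** A complex-linear functional is recovered from its real part [f] as [f v - i f (i v)]; over the
    reals [f] itself serves. *)
Lemma complexify (R : realType) (s : scalars) (V : lmodType (scalar_field R s))
    (f : V -> R) :
  (forall r v w, f (of_real s r *: v + w) = r * f v + f w) ->
  exists phi : {linear V -> (scalar_field R s)^o}, forall v, re (phi v) = f v.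
Proof.
move=> fl.
have build (g : V -> (scalar_field R s)^o) : linear g ->
    exists phi : {linear V -> (scalar_field R s)^o}, forall v, phi v = g v.
  move=> gl; pose gL := GRing.isLinear.Build _ _ _ _ g gl.
  by pose G : {linear V -> (scalar_field R s)^o} := HB.pack g gL; exists G.
case: s V f fl build => /= V f fl build.
  by have [phi phif] := build f fl; exists phi.
have fD v w : f (v + w) = f v + f w by have := fl 1 v w; rewrite rmorph1 scale1r mul1r.
have f0 : f 0 = 0 by have := fD 0 0; rewrite addr0; lra.
have fZ (r : R) v : f (r%:C%C *: v) = r * f v by have := fl r v 0; rewrite !addr0 f0 addr0.
pose g v : R[i]^o := (f v +i* - f ('i%C *: v))%C.
have [|phi phig] := build g; last by exists phi => v; rewrite phig.
move=> [a b] v w; rewrite /g.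
have -> : (a +i* b)%C = a%:C%C + b%:C%C * 'i%C.
  by apply/eqP; rewrite eq_complex /=; apply/andP; split; apply/eqP; ring.
rewrite scalerDl !scalerDr !fD.
rewrite -scalerA fZ fZ !scalerA.
have -> : 'i%C * a%:C%C = a%:C%C * 'i%C :> R[i] by rewrite mulrC.
have -> : 'i%C * (b%:C%C * 'i%C) = (- b)%:C%C :> R[i].
  by apply/eqP; rewrite eq_complex /=; apply/andP; split; apply/eqP; ring.
rewrite -scalerA !fZ.
by apply/eqP; rewrite eq_complex /=; apply/andP; split; apply/eqP; ring.
Qed.

Section duality.
Context (R : realType) (s : scalars).
Local Notation K := (scalar_field R s).

Lemma linear_re_bound (V : normedModType K) (phi : {linear V -> K^o}) :
  (forall v, re (phi v) <= rnorm v) -> forall v, rnorm (phi v) <= rnorm v.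
Proof.
move=> phi_re v; have [pv0|pv0] := eqVneq (phi v) 0.
  by rewrite pv0 rnorm0 rnorm_ge0.
(* rotate [v] so that [phi] takes the real value [`|phi v|] *)
pose theta := `|phi v| / phi v.
have theta1 : `|theta| = 1 by rewrite normrM normfV normr_id divff// normr_eq0.
have := phi_re (theta *: v); rewrite linearZ /= rnormZ theta1 -(of_real1 R s) re_of_real mul1r.
by apply: le_trans; rewrite /GRing.scale /= /theta divfK.
Qed.

Theorem norming_functional (V : normedModType K) (x : V) :
  exists phi : {linear V -> K^o},
    [/\ continuous phi, forall v, rnorm (phi v) <= rnorm v & re (phi x) = rnorm x].
Proof.
have [f [fl fb fx]] := real_hahn_banach x.
have [phi phif] := complexify fl.
have pb : forall v, rnorm (phi v) <= rnorm v.
  by apply: linear_re_bound => v; rewrite phif.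
exists phi; split => //; last by rewrite phif.
by apply: (@bounded_linear_continuousr _ _ _ _ phi 1) => v; rewrite mul1r.
Qed.

End duality.

(** * Closed spans and countable combinations *)

Section closed_subspaces.
Context (R : realType) (s : scalars).
Local Notation K := (scalar_field R s).
Variable V : normedModType K.

Lemma rnorm_quotient_map (Z : closedSubspace V) (x : V) :
  rnorm (quotient_map Z x : quotient Z) <= rnorm x.
Proof. by rewrite -(@ler_of_real R s) !rnormE; exact: quotient_norm_le. Qed.

(* A norming functional of the class of [x] in [V / Z], pulled back to [V]. *)
Lemma closed_subspace_separation (Z : closedSubspace V) (x : V) : ~ subspace_set Z x ->
  exists phi : {linear V -> K^o},
    [/\ continuous phi, forall z, subspace_set Z z -> phi z = 0 & phi x <> 0].
Proof.
move=> Zx; pose q := quotient_map Z : {linear V -> quotient Z}.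
have [psi [_ psib psix]] := norming_functional (q x).
exists (psi \o q); split.
- apply: (@bounded_linear_continuousr _ _ _ _ (psi \o q) 1) => v.
  by rewrite mul1r; apply: le_trans (psib _) (rnorm_quotient_map _ _).
- move=> z Zz /=; rewrite (_ : q z = 0) ?linear0//.
  by apply/quotient_mapP; rewrite subr0.
- move=> /= phix; apply: Zx; rewrite -[x]subr0; apply/quotient_mapP.
  by apply: (@rnorm_eq0 _ _ (quotient Z)); rewrite -psix phix -(of_real0 R s) re_of_real.
Qed.

End closed_subspaces.

(** Rational scalars, with index 0 reserved for the scalar 0: padding a list of indices by its
    default entry then adds only zero coefficients. *)
Lemma scalar_dense (R : realType) (s : scalars) :
  exists q : nat -> scalar_field R s, q 0 = 0 /\
    forall (a : scalar_field R s) (e : R), 0 < e ->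
      exists n, rnorm (a - q n : (scalar_field R s)^o) < e.
Proof.
have ratP (x e : R) : 0 < e -> exists r : rat, `|x - ratr r| < e.
  move=> e0; have /rat_in_itvoo[r] : x < x + e by rewrite ltrDl.
  by rewrite in_itv /= => /andP[xr rx]; exists r; rewrite ltr_norml; lra.
case: s => /=.
  exists (fun n => if n is n'.+1 then odflt 0 (omap ratr (@unpickle rat n')) else 0).
  split => // a e /(ratP a)[r ar]; exists (pickle r).+1.
  by rewrite pickleK.
pose g (z : rat * rat) : R[i] := (ratr z.1 +i* ratr z.2)%C.
exists (fun n => if n is n'.+1 then odflt 0 (omap g (unpickle n')) else 0).
split => // -[a b] e e0; have e20 : 0 < e / 2 by rewrite divr_gt0.
have [p ap] := ratP a _ e20; have [q bq] := ratP b _ e20.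
exists (pickle (p, q)).+1; rewrite pickleK /=.
rewrite -[ltRHS](ger0_norm (ltW e0)) -sqrtr_sqr ltr_sqrt ?exprn_gt0//.
move: ap bq; rewrite !ltr_norml => /andP[? ?] /andP[? ?]; nra.
Qed.

Section countable_combinations.
Context (R : realType) (s : scalars).
Local Notation K := (scalar_field R s).
Variables (V : normedModType K) (q : nat -> K) (v : nat -> V).
Hypothesis q0 : q 0 = 0.
Hypothesis q_dense : forall a (e : R), 0 < e -> exists n, rnorm (a - q n : K^o) < e.

(** Indexing by [seq nat], a countable type, lets a combination be encoded by one natural number;
    only the [v i] with [i < size c] enter. *)
Definition combination (c : seq nat) : V :=
  \sum_(i < size c) q (nth 0 c i) *: v i.

Lemma combination_widen c n : (size c <= n)%N ->
  combination c = \sum_(i < n) q (nth 0 c i) *: v i.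
Proof.
move=> cn; rewrite /combination (big_ord_widen_cond n predT (fun i => q (nth 0 c i) *: v i))//.
rewrite big_mkcond /=; apply: eq_bigr => i _; case: ltnP => // ci.
by rewrite nth_default// q0 scale0r.
Qed.

Lemma approx_combination n (b : nat -> K) (e : R) : 0 < e ->
  exists2 c, size c = n & rnorm (\sum_(i < n) b i *: v i - combination c) < e.
Proof.
(* Each term then contributes at most [e / n.+1], and there are only [n] of them, so the total stays
   strictly below [e]. *)
move=> e0; have d0 i : 0 < e / (n.+1%:R * (rnorm (v i) + 1)).
  by rewrite divr_gt0// mulr_gt0// ltr_wpDl// rnorm_ge0.
have [k kP] := choice (fun i => q_dense (b i) (d0 i)).
exists (mkseq k n); first by rewrite size_mkseq.
rewrite (combination_widen (n := n)) ?size_mkseq// -sumrB.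
apply: (@le_lt_trans _ _ (\sum_(i < n) e / n.+1%:R)); last first.
  rewrite sumr_const card_ord -[_ *+ n]mulr_natr mulrAC ltr_pdivrMr//.
  by rewrite ltr_pM2l// ltr_nat.
elim/big_ind2 : _ => [|x1 x2 y1 y2 h1 h2|i _]; first by rewrite rnorm0.
  by rewrite (le_trans (ler_rnormD _ _))// lerD.
rewrite nth_mkseq// -scalerBl rnormZ.
have := ltW (kP i); rewrite invfM mulrA ler_pdivlMr ?ltr_wpDl ?rnorm_ge0//.
apply: le_trans; rewrite ler_wpM2l ?re_norm_ge0//.
by rewrite lerDl.
Qed.

(** The coefficients [a * q i + q j] need not be values of [q], so they are approximated anew: a
    third of [e] goes to each of [x], [y] and this last approximation. *)
Lemma closure_combination_linear (a : K) x y :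
  closure (range combination) x -> closure (range combination) y ->
  closure (range combination) (a *: x + y).
Proof.
move=> /closure_rnormP clx /closure_rnormP cly; apply/closure_rnormP => e e0.
have a1 : 0 < re `|a| + 1 by rewrite ltr_wpDl ?re_norm_ge0.
have dx : 0 < e / 3 / (re `|a| + 1) by rewrite !divr_gt0.
have e3 : 0 < e / 3 by rewrite divr_gt0.
have [_ [c _ <-] xc] := clx _ dx; have [_ [d _ <-] yd] := cly _ e3.
pose n := maxn (size c) (size d).
have [f fn fP] := @approx_combination n (fun i => a * q (nth 0 c i) + q (nth 0 d i)) _ e3.
exists (combination f); first by exists f.
rewrite (splitr e); apply: (le_lt_trans (rnorm_tri (a *: combination c + combination d) _ _)).
have -> : a *: combination c + combination d =
    \sum_(i < n) (a * q (nth 0 c i) + q (nth 0 d i)) *: v i.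
  rewrite !(combination_widen (n := n)) ?leq_maxl ?leq_maxr//.
  by rewrite scaler_sumr -big_split; apply: eq_bigr => i _; rewrite scalerDl scalerA.
set w := \sum_(i < n) _ in fP *.
have : rnorm (a *: x + y - w) < e / 3 + e / 3; last lra.
have -> : a *: x + y - w = a *: (x - combination c) + (y - combination d).
  rewrite /w scalerBr [RHS]addrACA -opprD; congr (_ - _).
  rewrite !(combination_widen (n := n)) ?leq_maxl ?leq_maxr//.
  by rewrite scaler_sumr -big_split; apply: eq_bigr => i _; rewrite scalerDl scalerA.
apply: (le_lt_trans (ler_rnormD _ _)); rewrite ltrD// rnormZ.
move: xc; rewrite ltr_pdivlMr// => /le_lt_trans; apply.
by rewrite mulrC ler_wpM2l ?rnorm_ge0// lerDl.
Qed.

Lemma closure_combination0 : closure (range combination) 0.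
Proof. by apply: subset_closure; exists [::]; rewrite // /combination big_ord0. Qed.

Lemma closure_combination_gen n : closure (range combination) (v n).
Proof.
apply/closure_rnormP => e /(approx_combination n.+1 (fun i => (i == n)%:R))[c _ cP].
exists (combination c); first by exists c.
move: cP; rewrite (bigD1 ord_max)//= eqxx scale1r big1 ?addr0// => i /eqP ni.
case: eqP => [/= ni'|_]; last by rewrite scale0r.
by case: ni; exact: val_inj.
Qed.

Definition closed_span : closedSubspace V :=
  ClosedSubspace closure_combination0 closure_combination_linear (@closed_closure _ _).

End countable_combinations.

(** * Norm oscillation of weakly continuous functions *)

Section weak_continuity.
Context (R : realType) (s : scalars) (T : topologicalType).
Local Notation K := (scalar_field R s).
Variables (E : normedModType K) (f : T -> E).
Hypothesis wf : weakly_continuous f.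

(** Weak lower semicontinuity of the norm: a functional norming [f t - c] keeps its real part above
    [r] near [t]. *)
Lemma open_rnorm_gt (c : E) (r : R) : open [set t | r < rnorm (f t - c)].
Proof.
rewrite openE => t /= rt; have [phi [cphi phib phit]] := norming_functional (f t - c).
have e0 : 0 < rnorm (f t - c) - r by rewrite subr_gt0.
have /continuous_rnormP/(_ _ e0) := wf cphi (x := t).
apply: filterS => u /= tu; apply: lt_le_trans (le_trans (re_le_norm _) (phib _)).
have := le_lt_trans (re_le_norm _) tu; rewrite -phit linearB reB linearB.
by rewrite !reB; lra.
Qed.

(** Norm-closed subspaces are weakly closed: a continuous functional vanishing on [Z] would separate
    [f t] from it. *)
Lemma weak_limit_closed_subspace (Z : closedSubspace E) (t : T) :
  (forall U, nbhs t U -> exists2 u, U u & subspace_set Z (f u)) ->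
  subspace_set Z (f t).
Proof.
move=> tZ; apply: contrapT => /closed_subspace_separation[phi [cphi phiZ]]; apply.
apply: rnorm_eq0; apply/eqP; rewrite eq_le rnorm_ge0 andbT; apply/ler_addgt0Pr => e e0.
have /continuous_rnormP/(_ _ e0)/tZ [u /= tu /phiZ phiu] := wf cphi (x := t).
by move: tu; rewrite phiu subr0 add0r => /ltW.
Qed.

End weak_continuity.

Section norm_fragmentation.
Context (R : realType) (s : scalars) (T : topologicalType).
Local Notation K := (scalar_field R s).
Variables (E : normedModType K) (f : T -> E).
Hypothesis cT : compact [set: T].
Hypothesis hT : hausdorff_space T.
Hypothesis wf : weakly_continuous f.

(* A weakly continuous function on a compact space is nearly norm-continuous
   somewhere in every open set [U] (Namioka). Otherwise one finds shrinking open
   sets [V n] in [U] and points [t n] in [V n] such that [f] stays [e] away on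
   [V n] from the [n]-th countable combination of [f (t 0), f (t 1), ...]. At a
   cluster point [t] of the [t n], [f t] is in the closed span of the
   [f (t n)] although it is [e] away from a dense subset of it. *)
Theorem norm_fragmented (U : set T) (e : R) : open U -> U !=set0 -> 0 < e ->
  exists (V : set T) (c : E),
    [/\ open V, V !=set0, V `<=` U & forall t, V t -> rnorm (f t - c) <= e].
Proof.
move=> oU [t0 Ut0] e0; apply: contrapT => noV.
have [q [q0 q_dense]] := scalar_dense R s.
(* The stage is the length of [l], and its 2-adic valuation decodes to a combination. Every code
   thus recurs at arbitrarily late stages, once all the points it uses have been chosen. *)
pose d (l : seq T) : E :=
  if @unpickle (seq nat) (logn 2 (size l)) is Some c
  then combination q (fun i => f (nth t0 l i)) c else 0.
pose good (p : set T * seq T) := [/\ open p.1, p.1 !=set0 & p.1 `<=` U].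
pose next (p p' : {p | good p}) := [/\ closure (sval p').1 `<=` (sval p).1,
  forall t, (sval p').1 t -> e < rnorm (f t - d (sval p).2) &
  exists2 t, (sval p').1 t & (sval p').2 = rcons (sval p).2 t].
have nextP p : {p' | next p p'}.
  apply: cid; case: p => -[V l] [/= oV V0 VU].
  have [u [Vu eu]] : exists u, V u /\ e < rnorm (f u - d l).
    apply: contrapT => nou; apply: noV; exists V, (d l); split=> // t Vt.
    by rewrite leNgt; apply/negP => et; apply: nou; exists t.
  pose W := V `&` [set t | e < rnorm (f t - d l)].
  have oW : open W by apply: openI => //; exact: open_rnorm_gt.
  (* Compact Hausdorff spaces are regular, so [u] has an open neighbourhood whose closure stays in
     [W]. *)
  have [|||A [B [oA oB Au WB AB]]] := (regular_openP u).1 _ (~` W).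
  - exact: compact_regular hT cT filterT.
  - exact: open_closedC.
  - by case.
  have clAW : closure A `<=` W.
    rewrite -[W]setCK; apply: subset_trans (subsetC WB).
    rewrite closureE; apply: smallest_sub; first exact: open_closedC.
    exact/disjoints_subset.
  have gA : good (A, rcons l u).
    split => //=; first by exists u.
    by move=> t /subset_closure/clAW [/VU].
  exists (exist _ _ gA); split => /=.
  - by move=> t /clAW [].
  - by move=> t /subset_closure/clAW [].
  - by exists u.
have g0 : good (U, [::]) by split => //; exists t0.
have [p [p0 pS]] := dependent_choice nextP (exist _ _ g0).
pose V n := (sval (p n)).1; pose l n := (sval (p n)).2; pose t n := nth t0 (l n.+1) n.
have sizel n : size (l n) = n.
  elim: n => [|n IH]; first by rewrite /l p0.
  by have [_ _ [u _]] := pS n; rewrite /l => ->; rewrite size_rcons [size _]IH.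
have Vt n : V n.+1 (t n).
  have [_ _ [u Vu lu]] := pS n; rewrite /t {1}/l lu nth_rcons [size _]sizel ltnn eqxx.
  exact: Vu.
have lt n i : (i < n)%N -> nth t0 (l n) i = t i.
  elim: n => // n IH; rewrite ltnS leq_eqVlt => /predU1P[->//|ni].
  by have [_ _ [u _ lu]] := pS n; rewrite /l lu nth_rcons [size _]sizel ni; exact: IH.
have VS n : closure (V n.+1) `<=` V n by have [] := pS n.
have Vle m n : (m <= n)%N -> V n `<=` V m.
  move=> /subnK <-; elim: (n - m)%N => [|k IH]; first by rewrite add0n.
  by rewrite addSn; apply: subset_trans IH; apply: subset_trans (VS _); exact: subset_closure.
have [x [_ xt]] : [set: T] `&` cluster (t @ \oo) !=set0 by apply: cT; exact: filterT.
(* The points from index [n] on lie in [V n.+1], so a cluster point lies in its closure, hence in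
   [V n]. *)
have Vx n : V n x.
  apply: VS => A xA; apply: xt => //; exists n => // m /= nm.
  by apply: (Vle n.+1 m.+1) => //; exact: Vt.
have tZ : subspace_set (closed_span (fun n => f (t n)) q0 q_dense) (f x).
  apply: (weak_limit_closed_subspace wf) => A xA.
  have tr : (t @ \oo) (range t) by exists 0%N => // n _; exists n.
  have [_ [[n _ <-] Au]] := xt _ _ tr xA.
  by exists (t n) => //; exact: closure_combination_gen.
have [_ [c _ <-]] := (closure_rnormP _ _).1 tZ _ e0.
apply/negP; rewrite -leNgt ltW//.
(* The odd factor leaves the valuation equal to [pickle c] and makes [n] at least [size c], so stage
   [n] tests exactly this combination of the points chosen so far. *)
pose n := (2 ^ pickle c * (size c).*2.+1)%N.
have [_ /(_ x (Vx n.+1)) + _] := pS n.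
rewrite /d [size _]sizel /n lognM ?expn_gt0// pfactorK// logn_coprime; last first.
  by rewrite prime_coprime// dvdn2 /= odd_double.
rewrite addn0 pickleK; congr (_ < rnorm (_ - _)).
apply: eq_bigr => i _; congr (_ *: f _); apply: lt.
apply: leq_trans (ltn_ord i) _; rewrite /n.
apply: leq_trans (leq_pmull _ _); last by rewrite expn_gt0.
by rewrite -addnn -addnS leq_addr.
Qed.

End norm_fragmentation.

(** * Rich subspaces *)

Section bumps.
Context (R : realType) (T : topologicalType).
Hypothesis cT : compact [set: T].
Hypothesis hT : hausdorff_space T.

(** Urysohn's lemma for the complement of [V] and the singleton of [t], in a compact Hausdorff and
    hence normal space. *)
Lemma bump_function (V : set T) (t : T) : open V -> V t ->
  exists h : T -> R, [/\ continuous h, forall u, 0 <= h u <= 1, h t = 1 &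
    forall u, ~ V u -> h u = 0].
Proof.
move=> oV Vt; have nT := compact_normal hT cT.
have /uniform_separatorP : uniform_separator (~` V) [set t].
  apply: (normal_separatorP (R := R)).1 nT _ _ _ _ _.
  - exact: open_closedC.
  - exact/accessible_closed_set1/hausdorff_accessible.
  - by apply/disjoints_subset => u /= nVu ut; apply: nVu; rewrite ut.
move=> /(_ R)[h [ch h01 h0 h1]]; exists h; split => //.
- by move=> u; have := h01 (h u) (imageT _ _); rewrite /= in_itv.
- by apply: (h1 (h t)); exists t.
- by move=> u nVu; apply: (h0 (h u)); exists u.
Qed.

Hypothesis pT : perfect_set [set: T].

Lemma perfect_split (V : set T) : open V -> V !=set0 ->
  exists A B, [/\ open A, open B, A !=set0, B !=set0 & A `&` B = set0 /\ A `|` B `<=` V].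
Proof.
move=> oV [t Vt].
have [u [ut _ Vu]] : exists u, [/\ u != t, [set: T] u & V u].
  have : limit_point [set: T] t by rewrite pT.2.
  by move=> /(_ V); apply; apply: open_nbhs_nbhs.
move: hT; rewrite open_hausdorff => /(_ _ _ ut)[[A B] /=].
rewrite !inE => -[Au Bt] [oA oB AB].
exists (A `&` V), (B `&` V); split; [exact: openI|exact: openI|by exists u|by exists t|].
split; last by move=> ? [[]|[]].
by rewrite setIACA -subset0 => x [[Ax Bx] _]; rewrite -AB.
Qed.

(** Perfectness splits [V] into two disjoint open pieces: one carries a bump and the other the
    remaining [N] by induction. Disjointness of supports is recorded only through the bound on the
    sum. *)
Lemma disjoint_bumps N (V : set T) : open V -> V !=set0 ->
  exists (h : nat -> T -> R) (t : nat -> T),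
    [/\ forall i, continuous (h i), forall i u, 0 <= h i u <= 1,
      forall i u, ~ V u -> h i u = 0, forall u, \sum_(i < N) h i u <= 1 &
      forall i, (i < N)%N -> V (t i) /\ h i (t i) = 1].
Proof.
elim: N V => [|N IH] V oV V0.
  have [t Vt] := V0; exists (fun _ _ => 0), (fun=> t); split => //.
  - by move=> _ u; exact: cvg_cst.
  - by move=> _ _; rewrite lexx ler01.
  - by move=> u; rewrite big_ord0.
have [A [B [oA oB [a Aa] B0 [AB ABV]]]] := perfect_split oV V0.
have [h [t [hc h01 hV hs ht]]] := IH B oB B0.
have [k [kc k01 ka kA]] := bump_function oA Aa.
exists (fun i => if i is j.+1 then h j else k), (fun i => if i is j.+1 then t j else a).
split.
- by case.
- by case.
- by case=> [|i] u Vu; [apply: kA|apply: hV] => ?; apply: Vu; apply: ABV; [left|right].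
- move=> u; rewrite big_ord_recl /=.
  have [Au|nAu] := pselect (A u); last by rewrite kA// add0r; exact: hs.
  rewrite big1 ?addr0; first by have /andP[] := k01 u.
  by move=> i _ /=; apply: hV => Bu; have : (A `&` B) u by []; rewrite AB.
- case=> [_|i iN]; first by split => //; apply: ABV; left.
  by have [Bt ->] := ht i iN; split => //; apply: ABV; right.
Qed.

End bumps.

Section sup_normed_theory.
Context (R : realType) (s : scalars) (T : Type).
Local Notation K := (scalar_field R s).
Variables (E : normedModType K) (X : boundedFunctions T E).
Implicit Types f : sup_normed X.

Lemma rnorm_sup_normed f : rnorm f = sup [set rnorm (f t) | t in [set: T]].
Proof. exact: re_of_real. Qed.

Lemma rnorm_eval_le f t : rnorm (f t) <= rnorm f.
Proof. by rewrite rnorm_sup_normed ler_sup_norm. Qed.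

Lemma rnorm_sup_normed_le f M : 0 <= M -> (forall t, rnorm (f t) <= M) -> rnorm f <= M.
Proof.
move=> M0 fM; rewrite rnorm_sup_normed.
have [->|/set0P ne] := eqVneq [set rnorm (f t) | t in [set: T]] set0; first by rewrite sup0.
by apply: ge_sup => // _ [t _ <-].
Qed.

Lemma rnorm_eval_gt f r : 0 <= r -> r < rnorm f -> exists t, r < rnorm (f t).
Proof.
move=> r0 rf; apply: contrapT => nf; move: rf; apply/negP; rewrite -leNgt.
apply: rnorm_sup_normed_le => // t; rewrite leNgt; apply/negP => rt; apply: nf.
by exists t.
Qed.

Lemma eval_sum (t : T) (I : finType) (g : I -> sup_normed X) :
  (\sum_i g i) t = \sum_i g i t.
Proof. by rewrite (big_morph (fun f : sup_normed X => f t) (id1 := 0) (op1 := +%R)). Qed.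

End sup_normed_theory.

Section rich_criterion.
Context (R : realType) (s : scalars) (T : topologicalType).
Local Notation K := (scalar_field R s).
Variables (E : normedModType K) (X : boundedFunctions T E).
Hypothesis cT : compact [set: T].
Hypothesis hT : hausdorff_space T.
Hypothesis pT : perfect_set [set: T].
Hypothesis CX : forall f : T -> E, continuous f -> bf_carrier X f.

Lemma continuous_scaled_bump (h : T -> R) (w : E) : continuous h ->
  continuous (fun t => of_real s (h t) *: w).
Proof.
move=> ch t; apply/continuous_rnormP => e e0.
have d0 : 0 < e / (rnorm w + 1) by rewrite divr_gt0// ltr_wpDl// rnorm_ge0.
have /cvgrPdist_lt/(_ _ d0) := ch t; apply: filterS => u.
rewrite ltr_pdivlMr ?ltr_wpDl ?rnorm_ge0// -scalerBl -of_realN -of_realD rnormZr.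
by apply: le_lt_trans; rewrite ler_wpM2l// lerDl.
Qed.

(** Averaging: if all [N] real parts were at most [- r], that of the sum would be at most [- N r],
    below the bound [- M C] given by continuity. *)
Lemma exists_functional_gt (N : nat) (g : nat -> sup_normed X)
    (w : {linear sup_normed X -> K^o}) (M C r : R) :
  0 < M -> (forall x, rnorm (w x) <= M * rnorm x) ->
  rnorm (\sum_(i < N) g i) <= C -> M * C < N%:R * r ->
  exists2 i, (i < N)%N & - r < re (w (g i)).
Proof.
move=> M0 wM gC MCr; apply: contrapT => now.
have : re (w (\sum_(i < N) g i)) <= - (N%:R * r).
  have re0 : re (0 : K) = 0 by rewrite -(of_real0 R s) re_of_real.
  rewrite linear_sum (big_morph _ (@reD R s) re0) mulr_natl -mulNrn.
  rewrite -[X in _ *+ X]card_ord -sumr_const; apply: ler_sum => i _.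
  by rewrite leNgt; apply/negP => gi; apply: now; exists i.
have : - (M * C) <= re (w (\sum_(i < N) g i)); last lra.
rewrite lerNl -reN -linearN; apply: le_trans (re_le_norm _) _.
by apply: le_trans (wM _) _; rewrite rnormN ler_wpM2l// ltW.
Qed.

(** The criterion behind both richness results: all that depends on the space is the set [V] with
    its vector [c]. *)
Theorem rich_of_fragmented :
  (forall (x y : sup_normed X) (d : R), rnorm x = 1 -> 0 < d ->
    exists (V : set T) (c : E), [/\ open V, V !=set0,
      forall t, V t -> 1 - d < rnorm (x t) & forall t, V t -> rnorm (y t - c) <= d]) ->
  rich (C_sub X).
Proof.
move=> frag; split.
  pose q := quotient_map (C_sub X) : {linear _ -> quotient (C_sub X)}.
  apply: (@bounded_linear_continuousr _ _ _ _ q 1) => v.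
  by rewrite mul1r; exact: rnorm_quotient_map.
move=> x y e S x1 y1 e0 [_ [w [alpha [cw ->]]]] /= [_ wy].
have {}x1 : rnorm x = 1 by rewrite /rnorm x1 -(of_real1 R s) re_of_real.
have {}y1 : rnorm y = 1 by rewrite /rnorm y1 -(of_real1 R s) re_of_real.
have [M M0 wM] := linear_continuous_bound cw.
pose gam := re (w y) - alpha; have gam0 : 0 < gam by rewrite subr_gt0.
(* The bound 1 gives [rnorm c <= 2]. The bound [e / 4] covers the total loss [4 d] in the norm of
   [x + v]. The last one limits the effect of rescaling on [w] to half of the margin [gam]. *)
pose d := Num.min 1 (Num.min (e / 4) (gam / (2 * M))).
have d0 : 0 < d by rewrite !lt_min ltr01 !divr_gt0// mulr_gt0.
have d1 : d <= 1 by rewrite ge_min lexx.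
have de : d <= e / 4 by rewrite !ge_min lexx orbT.
have dM : M * d <= gam / 2.
  have : d <= gam / (2 * M) by rewrite !ge_min lexx !orbT.
  by rewrite invfM mulrA ler_pdivlMr// mulrC.
have [V [c [oV V0 Vx Vy]]] := frag x y d x1 d0.
have cd : rnorm c <= 1 + d.
  have [t Vt] := V0; rewrite -[c](subKr (y t)).
  apply: le_trans (ler_rnormB _ _) _; apply: lerD (Vy _ Vt).
  by rewrite -y1 rnorm_eval_le.
(* Enough bumps for some correction to lower [re (w y)] by less than the other half of [gam]; 3
   bounds the norm of their sum. *)
pose N := (Num.truncn (M * 3 / (gam / 2))).+1.
have NM : M * 3 < N%:R * (gam / 2).
  by rewrite -ltr_pdivrMr ?divr_gt0// /N truncnS_gt.
have [h [t [hc h01 hV hs ht]]] := disjoint_bumps R cT hT pT N oV V0.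
pose g0 i u := of_real s (h i u) *: (x (t i) - c).
have g0c i : continuous (g0 i) by exact: continuous_scaled_bump.
pose g i : sup_normed X := SupNormed (mem_set (CX (g0c i))).
have xc i : rnorm (x (t i) - c) <= 3.
  apply: le_trans (ler_rnormB _ _) _; have := rnorm_eval_le x (t i); lra.
have [||n nN gn] := @exists_functional_gt N g w M 3 (gam / 2) M0 wM.
- apply: rnorm_sup_normed_le => // u; rewrite eval_sum.
  apply: (@le_trans _ _ (\sum_(i < N) h i u * 3)).
    elim/big_ind2 : _ => [|? ? ? ? h1 h2|i _]; first by rewrite rnorm0.
      by rewrite (le_trans (ler_rnormD _ _))// lerD.
    have /andP[h0 _] := h01 i u.
    by rewrite rnormZr ger0_norm// ler_wpM2l.
  by rewrite -mulr_suml -[leRHS]mul1r ler_wpM2r.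
- exact: NM.
have [Vt h1] := ht n nN.
pose y' := y + g n.
have y'd : rnorm y' <= 1 + d.
  apply: rnorm_sup_normed_le => [|u]; first lra.
  have -> : y' u = y u + g0 n u by [].
  have /andP[h0 hle1] := h01 n u.
  have [Vu|nVu] := pselect (V u); last first.
    rewrite /g0 hV// of_real0 scale0r addr0.
    by have := rnorm_eval_le y u; lra.
  (* A convex combination of two vectors of the unit ball, plus an error of norm at most [d] on
     [V]. *)
  have -> : y u + g0 n u = of_real s (1 - h n u) *: y u + of_real s (h n u) *: x (t n)
     + of_real s (h n u) *: (y u - c).
    rewrite /g0 !scalerBr of_realD of_realN of_real1 scalerBl scale1r.
    by rewrite [RHS]addrA (addrAC (y u - _)) subrK addrA.
  have yu := rnorm_eval_le y u; have xt := rnorm_eval_le x (t n); have yc := Vy u Vu.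
  apply: le_trans (ler_rnormD _ _) _.
  apply: (@le_trans _ _ ((1 - h n u) + h n u + d)); last by rewrite subrK.
  apply: lerD.
    apply: le_trans (ler_rnormD _ _) _; rewrite !rnormZr !ger0_norm ?subr_ge0//.
    by rewrite y1 in yu; rewrite x1 in xt; rewrite lerD// ler_piMr// subr_ge0.
  by rewrite rnormZr ger0_norm//; have := rnorm_ge0 (y u - c); nra.
have p0 : 0 < 1 + d by rewrite ltr_wpDl.
pose v := of_real s (1 + d)^-1 *: y'.
have v1 : rnorm v <= 1.
  by rewrite rnormZr gtr0_norm ?invr_gt0// mulrC ler_pdivrMr// mul1r.
have vy' : rnorm (v - y') <= d.
  have -> : v - y' = of_real s (- d) *: v.
    rewrite /v scalerA -of_realM -[y' in X in _ - X]scale1r -scalerBl.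
    rewrite -(of_real1 R s) -of_realN -of_realD.
    congr (of_real s _ *: _); field; lra.
  by rewrite rnormZr normrN gtr0_norm// -[leRHS]mulr1 ler_wpM2l// ltW.
exists v; split.
- split; first by rewrite -(of_real1 R s) normr_rnorm.
  have -> : v = y + g n + (v - y') by rewrite addrC subrK.
  rewrite (linearD w (y + g n)) (linearD w y) !reD.
  have : - (gam / 2) <= re (w (v - y')).
    rewrite lerNl -reN -linearN; apply: le_trans (re_le_norm _) _.
    apply: le_trans (wM _) _; rewrite rnormN; apply: le_trans dM.
    by rewrite ler_wpM2l// ltW.
  by rewrite /gam in gn *; lra.
- rewrite (_ : 2 - of_real s e = of_real s (2 - e)); last first.
    by rewrite of_realD of_realN (of_realD s 1 1) of_real1.
  rewrite -rnormE ltr_of_real.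
  apply: lt_le_trans (rnorm_eval_le (x + v) (t n)).
  (* At the peak the bump equals 1, so [y'] takes the value [x (t n) + (y (t n) - c)]. *)
  have -> : (x + v) (t n) = of_real s 2 *: x (t n) + ((y (t n) - c) + (v - y') (t n)).
    have -> : (v - y') (t n) = v (t n) - (y (t n) + g0 n (t n)) by [].
    have -> : (x + v) (t n) = x (t n) + v (t n) by [].
    rewrite /g0 h1 (of_realD s 1 1) of_real1 scale1r scalerDl scale1r.
    have -> : y (t n) - c + (v (t n) - (y (t n) + (x (t n) - c))) = v (t n) - x (t n).
      by rewrite addrCA opprD opprB addrACA subrr add0r addKr.
    by rewrite -addrA (addrC _ (v _ - _)) subrK.
  have : rnorm (of_real s 2 *: x (t n)) - rnorm ((y (t n) - c) + (v - y') (t n)) <=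
    rnorm (of_real s 2 *: x (t n) + ((y (t n) - c) + (v - y') (t n))).
    by rewrite lerBlDr; apply: le_trans (ler_rnormB _ _); rewrite addrK.
  apply: lt_le_trans; rewrite rnormZr ger0_norm//.
  have := ler_rnormD (y (t n) - c) ((v - y') (t n)); have := rnorm_eval_le (v - y') (t n).
  by have := Vx _ Vt; have := Vy _ Vt; lra.
- rewrite -rnormE ltr_of_real.
  (* The correction is continuous, so the quotient sees only the rescaling. *)
  have -> : quotient_map (C_sub X) (y - v) = quotient_map (C_sub X) (y' - v).
    apply/quotient_mapP; rewrite opprB addrA subrK /y' opprD addrA subrr add0r.
    apply: (@subspaceN _ _ _ (C_sub X)); exact: g0c.
  apply: le_lt_trans (rnorm_quotient_map _ _) _; rewrite rnormB_sym.
  by apply: le_lt_trans vy' _; lra.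
Qed.

End rich_criterion.

(** * Topology of the unit interval *)

Section unit_interval_topology.
Context (R : realType).
Local Notation I := (I01 R).
Implicit Types t u : I.

Lemma I01_val_inj : injective (@I01_val R).
Proof. exact: val_inj. Qed.

Lemma I01_itv t : 0 <= I01_val t <= 1.
Proof. by have := valP t; rewrite inE /= in_itv. Qed.

Lemma exists_I01 (x : R) : 0 <= x <= 1 -> exists t : I, I01_val t = x.
Proof.
move=> x01; have x01' : x \in (`[0, 1]%classic : set R) by rewrite inE /= in_itv.
by exists (exist _ x x01').
Qed.

Lemma I01_val_continuous : continuous (@I01_val R).
Proof. exact: initial_continuous. Qed.

Lemma nbhs_I01P t (U : set I) : nbhs t U <->
  exists2 e : R, 0 < e & forall u, `|I01_val t - I01_val u| < e -> U u.
Proof.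
split=> [/nbhs_ballP[e /= e0 eU]|[e e0 eU]]; first by exists e.
by apply/nbhs_ballP; exists e.
Qed.

Lemma I01_right t (e : R) : I01_val t < 1 -> 0 < e ->
  exists2 u, I01_val t < I01_val u & `|I01_val t - I01_val u| < e.
Proof.
move=> t1 e0; have /andP[t0 _] := I01_itv t.
pose m := Num.min (e / 2) (1 - I01_val t).
have m0 : 0 < m by rewrite lt_min divr_gt0// subr_gt0.
have me : m <= e / 2 by rewrite ge_min lexx.
have m1 : m <= 1 - I01_val t by rewrite ge_min lexx orbT.
have [|u uE] := @exists_I01 (I01_val t + m); first by apply/andP; split; lra.
by exists u; rewrite uE ?ltr_norml; [lra|apply/andP; split; lra].
Qed.

Lemma I01_hausdorff : hausdorff_space I.
Proof.
rewrite open_hausdorff => t u; rewrite -(inj_eq I01_val_inj) => tu.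
have : hausdorff_space R by exact: norm_hausdorff.
rewrite open_hausdorff => /(_ _ _ tu)[[A B] /=]; rewrite !inE => -[At Bu] [oA oB AB].
exists (@I01_val R @^-1` A, @I01_val R @^-1` B); rewrite /= ?inE//; split.
- by apply: open_comp => // ? _; exact: I01_val_continuous.
- by apply: open_comp => // ? _; exact: I01_val_continuous.
- by rewrite -preimage_setI AB preimage_set0.
Qed.

Lemma I01_perfect : perfect_set [set: I].
Proof.
split; first exact: closedT.
apply/seteqP; split => // t _ U /nbhs_I01P[e e0 eU].
have [t1|t1] := ltP (I01_val t) 1.
  have [u tu ue] := I01_right t1 e0; exists u; split => //; last exact: eU.
  by rewrite -(inj_eq I01_val_inj) gt_eqF.
pose m := Num.min (e / 2) 1.
have m0 : 0 < m by rewrite lt_min ltr01 divr_gt0.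
have me : m <= e / 2 by rewrite ge_min lexx.
have m1 : m <= 1 by rewrite ge_min lexx orbT.
have tE : I01_val t = 1 by apply/eqP; rewrite eq_le t1 andbT; case/andP: (I01_itv t).
have [|u uE] := @exists_I01 (1 - m); first by apply/andP; split; lra.
exists u; split => //; last by apply: eU; rewrite tE uE ltr_norml; apply/andP; split; lra.
by rewrite -(inj_eq I01_val_inj) uE tE lt_eqF//; lra.
Qed.

End unit_interval_topology.

(** * Richness of the continuous functions in the two spaces *)

Section rich_examples.
Context (R : realType) (s : scalars).
Local Notation K := (scalar_field R s).

Lemma rich_Cw (T : topologicalType) (E : normedModType K) :
  compact [set: T] -> hausdorff_space T -> perfect_set [set: T] ->
  rich (C_sub (Cw T E)).
Proof.
move=> cT hT pT; apply: rich_of_fragmented => // [f cf|x y d x1 d0].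
  exact: continuous_Cw.
have wc (f : sup_normed (Cw T E)) : weakly_continuous f.
  by have [] := set_mem (sup_normedP f).
(* The maximum with 0 covers [d > 1]: the threshold has to be nonnegative. The set where [x] exceeds
   it is open by weak lower semicontinuity, and [y] is fragmented inside it. *)
have [||t xt] := @rnorm_eval_gt _ _ _ _ _ x (Num.max 0 (1 - d)).
- by rewrite le_max lexx.
- by rewrite x1 gt_max ltr01/= ltrBlDr ltrDl.
have oU := open_rnorm_gt (wc x) 0 (Num.max 0 (1 - d)).
have Ut : [set t | Num.max 0 (1 - d) < rnorm (x t - 0)] t by rewrite /= subr0.
have [V [c [oV V0 VU yc]]] := norm_fragmented cT hT (wc y) oU (ex_intro _ t Ut) d0.
exists V, c; split => // u /VU /=; rewrite subr0; apply: le_lt_trans.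
by rewrite le_max lexx orbT.
Qed.

Lemma rich_D01 : rich (C_sub (D01 R s)).
Proof.
apply: rich_of_fragmented; first exact: compact_I01.
- exact: I01_hausdorff.
- exact: I01_perfect.
- exact: continuous_cadlag.
move=> x y d x1 d0.
have cl (f : sup_normed (D01 R s)) : cadlag f by have := set_mem (sup_normedP f).
have [||t] := @rnorm_eval_gt _ _ _ _ _ x (Num.max 0 (1 - d)).
- by rewrite le_max lexx.
- by rewrite x1 gt_max ltr01/= ltrBlDr ltrDl.
rewrite gt_max => /andP[_ xt].
(* Stated for a filter so as to serve both full neighbourhoods, at the endpoint 1, and right
   neighbourhoods, elsewhere; the vector [c] is [y t]. *)
have near (F : set_system (I01 R)) (FF : Filter F) : x @ F --> x t -> y @ F --> y t ->
    \forall u \near F, 1 - d < rnorm (x u) /\ rnorm (y u - y t) <= d.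
  move=> /cvg_rnormP xF /cvg_rnormP yF.
  have e0 : 0 < rnorm (x t) - (1 - d) by rewrite subr_gt0.
  apply: filterS2 (xF _ e0) (yF _ d0) => u xu yu; split; last by rewrite rnormB_sym ltW.
  by have := ler_rnormB_dist (x t) (x u); rewrite ler_norml => /andP[_]; lra.
have [t1|t1] := ltP (I01_val t) 1; last first.
  have {}t1 : I01_val t = 1 by apply/eqP; rewrite eq_le t1 andbT; case/andP: (I01_itv t).
  have [_ _ _ /(_ t t1) xc] := cl x; have [_ _ _ /(_ t t1) yc] := cl y.
  have := near _ (nbhs_filter t) xc yc; rewrite /prop_near1 nbhsE => -[V [oV Vt] VP].
  by exists V, (y t); split; [|exists t|move=> u /VP[]|move=> u /VP[]].
have [_ /(_ t) xc _ _] := cl x; have [_ /(_ t) yc _ _] := cl y.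
have := near _ (within_filter _ (nbhs_filter t)) xc yc.
rewrite /prop_near1 /= nbhsE => -[V [oV Vt] VP].
exists (V `&` @I01_val R @^-1` `]I01_val t, +oo[), (y t); split.
- apply: openI => //; apply: open_comp; last exact: interval_open.
  by move=> ? _; exact: I01_val_continuous.
- have /nbhs_I01P[e e0 eV] : nbhs t V by exact: open_nbhs_nbhs.
  have [u tu ue] := I01_right t1 e0.
  by exists u; split; [exact: eV|rewrite /= in_itv /= andbT].
- by move=> u [Vu]; rewrite /= in_itv /= andbT => tu; have [] := VP u Vu tu.
- by move=> u [Vu]; rewrite /= in_itv /= andbT => tu; have [] := VP u Vu tu.
Qed.

End rich_examples.

(** * Separability *)

Section separability.
Context (R : realType) (s : scalars).
Local Notation K := (scalar_field R s).

Lemma separable_family (W : normedModType K) (A : set W) (J : countType) (g : J -> W) :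
  (forall j, A (g j)) ->
  (forall x, A x -> forall e : R, 0 < e -> exists j, rnorm (x - g j) < e) ->
  separable A.
Proof.
move=> Ag gd; exists (range g); split.
- exact: sub_countable (card_image_le _ _) (countableP _).
- by move=> _ [j _ <-].
- move=> x Ax; apply/closure_rnormP => e e0.
  by have [j xj] := gd x Ax e e0; exists (g j) => //; exists j.
Qed.

Lemma separable_scalars : separable [set: K^o].
Proof.
have [q [_ qd]] := scalar_dense R s.
by apply: (@separable_family K^o _ nat q) => // x _ e e0; exact: qd.
Qed.

Lemma separable_sequence (W : normedModType K) : separable [set: W] ->
  exists d : nat -> W, forall x (e : R), 0 < e -> exists n, rnorm (x - d n) < e.
Proof.
move=> [B [cB _ dB]].
have [B0|[f]] := pfcard_geP cB.
  have /dB/closure_rnormP/(_ _ ltr01)[y] : [set: W] 0 by [].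
  by rewrite B0.
exists f => x e e0; have /dB/closure_rnormP/(_ _ e0)[y By xy] : [set: W] x by [].
by have [n _ fn] := (@surj _ _ _ _ f) _ By; exists n; rewrite fn.
Qed.

End separability.

Section hat_functions.
Context (R : realType).
Implicit Types x : R.

Definition ramp x : R := Num.max 0 (Num.min x 1).

(** The tent of height 1 at [k] supported on [[k - 1, k + 1]]. Written as a difference of ramps, the
    tents have telescoping sums. *)
Definition hat k x : R := ramp (x - k%:R + 1) - ramp (x - k%:R).

Lemma rampE x : ramp x = if x <= 0 then 0 else if 1 <= x then 1 else x.
Proof. by rewrite /ramp /Num.max /Num.min; do ![case: ifP] => *; lra. Qed.

Lemma hat_ge0 k x : 0 <= hat k x.
Proof. by rewrite /hat !rampE; do ![case: ifP] => *; lra. Qed.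

Lemma hat_eq0 k x : 1 <= `|x - k%:R| -> hat k x = 0.
Proof.
by rewrite /hat !rampE ler_normr => /orP[] ?; do ![case: ifP] => *; lra.
Qed.

Lemma sum_hat n x : 0 <= x <= n%:R -> \sum_(k < n.+1) hat k x = 1.
Proof.
have -> : \sum_(k < n.+1) hat k x = ramp (x + 1) - ramp (x - n%:R).
  elim: n => [|n IH]; first by rewrite big_ord1 /hat subr0.
  rewrite big_ord_recr IH /= /hat (_ : x - n.+1%:R + 1 = x - n%:R) ?subrKA//.
  by rewrite -natr1 opprD addrA subrK.
by move=> /andP[? ?]; rewrite !rampE; do ![case: ifP] => *; lra.
Qed.

Lemma hat_continuous k : continuous (hat k).
Proof.
have cr : continuous ramp.
  move=> x; apply: (@continuous_max R R (cst 0) (fun y => Num.min y 1)).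
    exact: cst_continuous.
  apply: (@continuous_min R R id (cst 1)); first exact: cvg_id.
  exact: cst_continuous.
move=> x; apply: cvgB; apply: continuous_cvg; try exact: cr.
- by apply: cvgD; [apply: cvgB; [exact: cvg_id|exact: cvg_cst]|exact: cvg_cst].
- by apply: cvgB; [exact: cvg_id|exact: cvg_cst].
Qed.

End hat_functions.

Section separable_continuous_functions.
Context (R : realType) (s : scalars).
Local Notation K := (scalar_field R s).
Local Notation I := (I01 R).
Variables (E : normedModType K) (X : boundedFunctions I E).
Hypothesis CX : forall f : I -> E, continuous f -> bf_carrier X f.

(** Heine-Cantor through near coverings: halving the local radius [d] at [t] leaves room for both a
    nearby [t'] and a point [u] close to [t']. *)
Lemma I01_uniform_continuity (f : I -> E) (e : R) : continuous f -> 0 < e ->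
  exists n : nat, forall t u, `|I01_val t - I01_val u| <= n.+1%:R^-1 ->
    rnorm (f t - f u) <= e.
Proof.
move=> cf e0.
have /compact_near_coveringP nc := @compact_I01 R.
have [|n _ nP] := nc nat \oo (fun n t => forall u, `|I01_val t - I01_val u| <= n.+1%:R^-1 ->
    rnorm (f t - f u) <= e) _.
- move=> t _; have e20 : 0 < e / 2 by rewrite divr_gt0.
  have /continuous_rnormP/(_ _ e20)/nbhs_I01P[d d0 dP] := cf t.
  have d20 : 0 < d / 2 by rewrite divr_gt0.
  exists ([set t' | `|I01_val t - I01_val t'| < d / 2], [set n | n.+1%:R^-1 < d / 2]) => /=.
    split; first by apply/nbhs_I01P; exists (d / 2).
    exact: near_infty_natSinv_lt (PosNum d20).
  move=> [t' n] /= [tt' nd] u t'u.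
  apply: le_trans (rnorm_tri (f t) _ _) _; rewrite (splitr e) lerD// ltW//.
    by rewrite rnormB_sym; apply: dP; lra.
  apply: dP; apply: (@le_lt_trans _ _ (`|I01_val t - I01_val t'| + `|I01_val t' - I01_val u|)).
    exact: ler_distD.
  by rewrite (splitr d) ltrD//; apply: le_lt_trans nd.
- by exists n => t u; apply: (nP n) => /=.
Qed.

Lemma separable_C_sub_I01 : separable [set: E] -> separable (C_sub X).
Proof.
move=> /separable_sequence[d dP].
(* Piecewise-linear interpolation of mesh [1 / n.+1]; the [n.+2] nodes take values in the dense
   sequence [d], with indices listed by [z.2]. *)
pose g (z : nat * seq nat) t : E :=
  \sum_(k < z.1.+2) of_real s (hat k (z.1.+1%:R * I01_val t)) *: d (nth 0%N z.2 k).
have gc z : continuous (g z).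
  apply: continuous_big => [|k _]; first exact: add_continuous.
  apply: continuous_scaled_bump => u.
  apply: (continuous_comp (f := fun u => z.1.+1%:R * I01_val u)); last exact: hat_continuous.
  apply: (continuous_comp (f := @I01_val R)); first exact: I01_val_continuous.
  exact: mulrl_continuous.
pose G z : sup_normed X := SupNormed (mem_set (CX (gc z))).
apply: (@separable_family _ _ _ _ _ G) => [z|f cf e e0]; first exact: gc.
have e30 : 0 < e / 3 by rewrite divr_gt0.
have [n nP] := I01_uniform_continuity cf e30.
have N0 : 0 < n.+1%:R :> R by rewrite ltr0n.
have grid k : exists t : I, (k < n.+2)%N -> I01_val t = k%:R / n.+1%:R.
  have [kn|kn] := boolP (k < n.+2)%N; last first.
    by have [|u _] := @exists_I01 R 0; [rewrite lexx ler01|exists u].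
  have [|t tE] := @exists_I01 R (k%:R / n.+1%:R); last by exists t.
  by rewrite divr_ge0//= ler_pdivrMr// mul1r ler_nat -ltnS.
have [pt ptP] := choice grid.
have [c cP] := choice (fun k => dP (f (pt k)) _ e30).
exists (n, mkseq c n.+2).
apply: (@le_lt_trans _ _ (e / 3 + e / 3)); last lra.
apply: rnorm_sup_normed_le => [|t]; first lra.
have -> : (f - G (n, mkseq c n.+2)) t = f t - g (n, mkseq c n.+2) t by [].
have /andP[t0 t1] := I01_itv t.
have h1 : \sum_(k < n.+2) hat k (n.+1%:R * I01_val t) = 1.
  by apply: sum_hat; rewrite mulr_ge0//= ler_piMr.
(* The tents form a partition of unity, so the error is a convex combination of errors at nodes, and
   nodes at distance [1 / n.+1] or more from [t] have weight 0. *)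
have -> : f t = \sum_(k < n.+2) of_real s (hat k (n.+1%:R * I01_val t)) *: f t.
  rewrite -scaler_suml -(big_morph _ (@of_realD R s) (of_real0 R s)) h1.
  by rewrite of_real1 scale1r.
rewrite /g -sumrB -[leRHS]mul1r -[X in _ <= X * _]h1 mulr_suml /=.
elim/big_ind2 : _ => [|? ? ? ? h2 h3|k _]; first by rewrite rnorm0.
  by rewrite (le_trans (ler_rnormD _ _))// lerD.
rewrite -scalerBr rnormZr ger0_norm ?hat_ge0//.
have [/hat_eq0 ->|tk] := leP 1 `|n.+1%:R * I01_val t - k%:R|; first by rewrite !mul0r.
rewrite ler_wpM2l ?hat_ge0// nth_mkseq//.
apply: le_trans (rnorm_tri (f (pt k)) _ _) _; apply: lerD; last exact/ltW/cP.
apply: nP; rewrite ptP//.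
have -> : I01_val t - k%:R / n.+1%:R = (n.+1%:R * I01_val t - k%:R) / n.+1%:R.
  by rewrite mulrBl mulrAC divff ?mul1r// lt0r_neq0.
by rewrite normrM normfV (gtr0_norm N0) ler_piMl ?invr_ge0 ?ltW.
Qed.

End separable_continuous_functions.

(** * The sequence space lp *)

Section lp_theory.
Context (R : realType) (s : scalars) (p : R) (p1 : 1 <= p).
Local Notation K := (scalar_field R s).
Local Notation lp := (lp s p1).
Implicit Types x y : lp.

Let p0 : 0 < p. Proof. exact: lt_le_trans ltr01 p1. Qed.

Let lp_Lnorm_powR (x : nat -> K^o) :
  (lp_Lnorm p x `^ p = \sum_(0 <= k <oo) (rnorm (x k) `^ p)%:E)%E.
Proof.
rewrite /lp_Lnorm Lnorm_counting// -poweRrM mulVf ?gt_eqF// poweRe1.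
  by apply: eq_eseriesr => k _; rewrite /= ger0_norm ?rnorm_ge0.
by apply: nneseries_ge0 => k _ _; rewrite poweR_ge0.
Qed.

Lemma rnorm_lp_powR x :
  ((rnorm x `^ p)%:E = \sum_(0 <= k <oo) (rnorm (x k) `^ p)%:E)%E.
Proof.
rewrite -lp_Lnorm_powR -poweR_EFin; congr (_ `^ _)%E.
rewrite /rnorm re_of_real fineK// ge0_fin_numE; last exact: Lnorm_ge0.
by have := lpP x; rewrite inE.
Qed.

Let powR_ge0E (x : nat -> K^o) k : (0 <= (rnorm (x k) `^ p)%:E)%E.
Proof. by rewrite lee_fin powR_ge0. Qed.

Let finite_support_sum (a : nat -> K^o) n : (forall k, (n <= k)%N -> a k = 0) ->
  (\sum_(0 <= k <oo) (rnorm (a k) `^ p)%:E = (\sum_(k < n) rnorm (a k) `^ p)%:E)%E.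
Proof.
move=> a0; rewrite (nneseries_split 0 n) ?add0n; last first.
  by move=> k _; rewrite lee_fin powR_ge0.
rewrite eseries0 ?adde0 ?sumEFin ?big_mkord// => k nk _.
by rewrite a0// rnorm0 powR0// gt_eqF.
Qed.

Lemma finite_support_lp (a : nat -> K^o) n : (forall k, (n <= k)%N -> a k = 0) ->
  a \in lp_pred p1.
Proof.
move=> a0; rewrite inE /=; apply: (@lty_poweRy _ _ p); first by rewrite gt_eqF.
by rewrite lp_Lnorm_powR (finite_support_sum a0) ltry.
Qed.

Lemma rnorm_finite_support x n : (forall k, (n <= k)%N -> x k = 0) ->
  rnorm x `^ p = \sum_(k < n) rnorm (x k) `^ p.
Proof.
by move=> /finite_support_sum xn; apply: EFin_inj; rewrite rnorm_lp_powR xn.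
Qed.

Fact lp_unit_subproof n : (fun k => (k == n)%:R : K^o) \in lp_pred p1.
Proof. by apply: (@finite_support_lp _ n.+1) => k nk; rewrite gtn_eqF. Qed.

Definition lp_unit n : lp := Lp (lp_unit_subproof n).

Lemma lp_sum_eval (I : finType) (f : I -> lp) k : (\sum_i f i) k = \sum_i f i k.
Proof. by rewrite (big_morph (fun x : lp => x k) (id1 := 0) (op1 := +%R)). Qed.

Lemma sum_lp_unit (a : nat -> K) n k :
  (\sum_(i < n) a i *: lp_unit i) k = if (k < n)%N then a k else 0 :> K^o.
Proof.
rewrite lp_sum_eval.
rewrite (eq_bigr (fun i : 'I_n => a i * (k == i)%:R : K^o))//.
case: ltnP => kn.
  rewrite (bigD1 (Ordinal kn))//= eqxx mulr1 big1 ?addr0// => i ik.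
  by rewrite (_ : (k == i) = false) ?mulr0//; apply: contraNF ik => /eqP ki; apply/eqP/val_inj.
rewrite big1// => i _; rewrite gtn_eqF ?mulr0//.
exact: leq_trans (ltn_ord i) kn.
Qed.

Lemma rnorm_sum_lp_unit (a : nat -> K) n :
  rnorm (\sum_(i < n) a i *: lp_unit i) `^ p = \sum_(i < n) rnorm (a i : K^o) `^ p.
Proof.
rewrite (@rnorm_finite_support _ n) => [|k nk]; last by rewrite sum_lp_unit ltnNge nk.
by apply: eq_bigr => i _; rewrite sum_lp_unit ltn_ord.
Qed.

Lemma rnorm_lp_unit n : rnorm (lp_unit n) = 1.
Proof.
apply: (powR_injective p0); rewrite ?nnegrE ?rnorm_ge0//.
rewrite powR1 (@rnorm_finite_support _ n.+1) => [|k nk]; last by rewrite /= gtn_eqF.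
rewrite (bigD1 ord_max)//= eqxx /rnorm normr1 -(of_real1 R s) re_of_real powR1.
rewrite big1 ?addr0// => i ni; rewrite (_ : (nat_of_ord i == n) = false).
  by rewrite normr0 -(of_real0 R s) re_of_real powR0// gt_eqF.
by apply: contraNF ni => /eqP ni; apply/eqP/val_inj.
Qed.

(** A vector is first truncated, the tails of its convergent [p]-th power series being small; its
    finitely many remaining coordinates are then approximated. *)
Lemma separable_lp : separable [set: lp].
Proof.
have [q [q0 qd]] := scalar_dense R s.
apply: (@separable_family _ _ _ _ _ (combination q lp_unit)) => // x _ e e0.
have e20 : 0 < e / 2 by rewrite divr_gt0.
have [n xn] : exists n, rnorm (x - \sum_(i < n) (x i : K) *: lp_unit i) < e / 2.
  have fin : (\sum_(0 <= k <oo) (rnorm (x k) `^ p)%:E < +oo)%E.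
    by rewrite -rnorm_lp_powR ltry.
  have tc := nneseries_tail_cvg fin (fun k _ => powR_ge0E x k).
  have d0 : (0 < ((e / 2) `^ p)%:E)%E by rewrite lte_fin powR_gt0.
  have [n _ /(_ n (leqnn n)) xn] := tc _ (open_ereal_lt' d0).
  exists n; set y := x - _.
  have yE k : y k = if (k < n)%N then 0 else x k :> K^o.
    have -> : y k = x k - (\sum_(i < n) (x i : K) *: lp_unit i) k by [].
    by rewrite (sum_lp_unit (x : nat -> K)); case: ltnP; rewrite ?subrr ?subr0.
  clearbody y; rewrite ltNge; apply/negP => /(ge0_ler_powR (ltW p0)).
  rewrite !nnegrE rnorm_ge0 ltW// => /(_ isT isT); apply/negP; rewrite -ltNge.
  rewrite -lte_fin rnorm_lp_powR (nneseries_split 0 n) ?add0n; last first.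
    by move=> k _; rewrite lee_fin powR_ge0.
  rewrite big1_seq ?add0e; last first.
    by move=> k; rewrite mem_index_iota /= => kn; rewrite yE kn rnorm0 powR0// gt_eqF.
  rewrite (_ : (\sum_(n <= k <oo) _)%E = (\sum_(n <= k <oo) (rnorm (x k) `^ p)%:E)%E)//.
  rewrite eseries_cond [RHS]eseries_cond.
  by apply: eq_eseriesr => k /= nk; rewrite yE ltnNge nk.
have [c _ xc] := approx_combination lp_unit q0 qd n (x : nat -> K) e20.
exists c; rewrite (splitr e); apply: le_lt_trans (rnorm_tri _ _ _) (ltrD xn xc).
Qed.

End lp_theory.
Section weakly_null_units.
Context (R : realType) (s : scalars) (p : R) (p1 : 1 < p).
Local Notation K := (scalar_field R s).
Local Notation lp := (lp s (ltW p1)).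
Local Notation e := (lp_unit s (ltW p1)).

(* If [N] of the values [phi (e n)] have modulus at least [d], the sum of the
   corresponding rotated unit vectors has norm [N `^ p^-1], so that
   [N * d <= M * N `^ p^-1]: this bounds [N] because [1 < p]. *)
Lemma lp_unit_weakly_null (phi : {linear lp -> K^o}) (d : R) :
  continuous phi -> 0 < d ->
  exists N, forall n, (N <= n)%N -> rnorm (phi (e n)) < d.
Proof.
move=> /linear_continuous_bound[M M0 phiM] d0.
have p0 : 0 < p by exact: lt_trans ltr01 p1.
have pm1 : 0 < p - 1 by rewrite subr_gt0.
(* [c] marks the indices with a large value, and [S m] counts those below [m]. *)
pose c n : R := if d <= rnorm (phi (e n)) then 1 else 0.
have c0 n : 0 <= c n by rewrite /c; case: ifP; rewrite ?ler01.
pose S m := \sum_(n < m) c n.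
have S0 m : 0 <= S m by exact: sumr_ge0.
pose theta n : K := of_real s (c n) * (`|phi (e n)| / phi (e n)).
(* The solution of [(d S) ^ p = M ^ p S] for positive [S]. *)
pose C := ((M / d) `^ p) `^ (p - 1)^-1.
have SC m : S m <= C.
  have [->|Sm] := eqVneq (S m) 0; first exact: powR_ge0.
  have {}Sm : 0 < S m by rewrite lt_def Sm S0.
  pose x := \sum_(i < m) theta i *: e i.
  have x_le : rnorm x `^ p <= S m.
    rewrite rnorm_sum_lp_unit; apply: ler_sum => i _.
    rewrite /theta /c; case: (leP d (rnorm (phi (e i)))) => dphi; last first.
      by rewrite of_real0 mul0r rnorm0 powR0// gt_eqF.
    have phi0 : phi (e i) != 0 by rewrite -rnorm_gt0; exact: lt_le_trans dphi.
    rewrite of_real1 mul1r /rnorm normrM normfV normr_id divff ?normr_eq0//.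
    by rewrite -(of_real1 R s) re_of_real powR1.
  have phix : d * S m <= rnorm (phi x).
    rewrite linear_sum.
    have -> : \sum_(i < m) phi (theta i *: e i) =
        of_real s (\sum_(i < m) c i * rnorm (phi (e i))) :> K^o.
      rewrite (big_morph _ (@of_realD R s) (of_real0 R s)); apply: eq_bigr => i _.
      rewrite linearZ; change (theta i * phi (e i) = of_real s (c i * rnorm (phi (e i))) :> K).
      rewrite /theta /c; case: (leP d (rnorm (phi (e i)))) => dphi; last first.
        by rewrite of_real0 !mul0r of_real0.
      have phi0 : phi (e i) != 0 by rewrite -rnorm_gt0; exact: lt_le_trans dphi.
      by rewrite of_real1 !mul1r divfK// rnormE.
    rewrite /rnorm norm_of_real; apply: le_trans (ler_norm _).
    rewrite mulr_sumr; apply: ler_sum => i _; rewrite /c.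
    by case: (leP d (rnorm (phi (e i)))) => dphi; rewrite ?mulr0 ?mul0r// mulr1 mul1r.
  have dS : (d * S m) `^ p <= M `^ p * S m.
    apply: (@le_trans _ _ ((M * rnorm x) `^ p)).
      apply: ge0_ler_powR; rewrite ?nnegrE ?mulr_ge0 ?rnorm_ge0 ?(ltW M0) ?(ltW p0) ?(ltW d0)//.
      exact: le_trans phix (phiM x).
    by rewrite powRM ?rnorm_ge0 ?(ltW M0)// ler_wpM2l ?powR_ge0.
  have SMd : S m `^ (p - 1) <= (M / d) `^ p.
    have dp : 0 < d `^ p by exact: powR_gt0.
    rewrite -(ler_pM2r dp) -powRM ?divr_ge0 ?(ltW M0) ?(ltW d0)// divfK ?gt_eqF//.
    rewrite -(ler_pM2r Sm); apply: le_trans dS.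
    rewrite powRM ?(ltW d0)// [leRHS]mulrC -mulrA [_ * S m]mulrC mulrA ler_wpM2r ?powR_ge0//.
    rewrite -[X in _ * X](powRr1 (S0 m)) -powRD ?subrK//.
    by rewrite (gt_eqF Sm) implybT.
  rewrite -[S m](powRr1 (S0 m)) -(@divff _ (p - 1)) ?gt_eqF// powRrM.
  by apply: ge0_ler_powR; rewrite ?nnegrE ?powR_ge0 ?invr_ge0// ltW.
(* The counts are monotone and bounded, so the 0-1 sequence [c] is summable, tends to 0 and is
   eventually 0. *)
have : cvgn (series c).
  apply: nondecreasing_is_cvgn; last first.
    by exists C => _ [m _ <-]; rewrite /series /= big_mkord; exact: SC.
  by apply: nondecreasing_series => n _ _.
move=> /cvg_series_cvg_0/cvgrPdist_lt/(_ _ ltr01)[N _ NP]; exists N => n Nn.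
have := NP n Nn; rewrite /= sub0r normrN /c; case: (leP d (rnorm (phi (e n)))) => // _.
by rewrite normr1 ltxx.
Qed.

End weakly_null_units.

(** * Nonseparability *)

Section nonseparability.
Context (R : realType) (s : scalars).
Local Notation K := (scalar_field R s).

(** Two members at distance at least 1 cannot both be within [1 / 2] of the same term of a dense
    sequence, so choosing such a term injects [J] into the naturals. *)
Lemma nonseparable_family (W : normedModType K) (J : Type) (f : J -> W) :
  ~ countable [set: J] -> (forall i j, i <> j -> 1 <= rnorm (f i - f j)) ->
  ~ separable [set: W].
Proof.
move=> ncJ fs /separable_sequence[d dP]; apply: ncJ.
have h0 : 0 < 1 / 2 :> R by rewrite divr_gt0.
have [n nP] := choice (fun j => dP (f j) _ h0).
apply/countable_injP; exists n => i j _ _ nij; apply: contrapT => /fs; apply/negP.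
rewrite -ltNge; apply: le_lt_trans (rnorm_tri (d (n i)) _ _) _.
have := nP i; have := nP j; rewrite nij (rnormB_sym (f j)); lra.
Qed.

Lemma uncountable_bool_sequences : ~ countable [set: nat -> bool].
Proof.
move=> /countable_injP[g ginj].
(* Cantor's diagonal sequence. *)
pose A n : bool := `[< exists2 B, g B = n & ~~ B n >].
have [AA|AA] := boolP (A (g A)).
  have /asboolP[B gB] := AA; have -> : B = A by apply: ginj; rewrite ?in_setT.
  by rewrite AA.
by have /asboolPn := AA; apply; exists A.
Qed.

(** A countable set has Lebesgue measure 0, whereas [[0, 1]] has measure 1. *)
Lemma uncountable_I01 : ~ countable [set: I01 R].
Proof.
move=> cI; have : countable (range (@I01_val R)) by exact: sub_countable (card_image_le _ _) cI.
have -> : range (@I01_val R) = `[0, 1]%classic.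
  apply/seteqP; split => [_ [t _ <-]|x]; rewrite /= in_itv /=; first exact: I01_itv.
  by move=> /exists_I01[t tx]; exists t.
move=> /countable_lebesgue_measure0; rewrite lebesgue_measure_itv /= lte_fin ltr01.
by move=> /eqP; rewrite oppr0 adde0 eqe oner_eq0.
Qed.

Definition jump (c : R) (u : I01 R) : K^o := if c <= I01_val u then 1 else 0.

Lemma jump_cadlag c : c < 1 -> cadlag (jump c).
Proof.
move=> c1.
have near_const (F : set_system (I01 R)) (l : K^o) : Filter F ->
    (\forall u \near F, jump c u = l) -> jump c @ F --> l.
  by move=> FF Fl; apply/cvg_rnormP => d d0; apply: filterS Fl => u ->; rewrite subrr rnorm0.
have lt_near t : c < I01_val t -> \forall u \near t, jump c u = 1.
  move=> ct; apply/nbhs_I01P; exists (I01_val t - c); first by rewrite subr_gt0.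
  by move=> u; rewrite ltr_norml /jump => /andP[_ ?]; rewrite (_ : c <= _)//; lra.
split.
- exists 1; split; first exact: real1.
  move=> x x1 u _; rewrite /= /jump; case: ifP => _; first by rewrite normr1 ltW.
  by rewrite normr0 ltW// (lt_trans _ x1).
- move=> t; apply: near_const; rewrite /jump; case: (leP c (I01_val t)) => ct.
    by apply/nbhs_I01P; exists 1 => // u _ tu; rewrite (le_trans ct (ltW tu)).
  apply/nbhs_I01P; exists (c - I01_val t); first by rewrite subr_gt0.
  by move=> u; rewrite ltr_norml => /andP[? _] _; rewrite leNgt (_ : _ < c)//; lra.
- move=> t; have [tc|ct] := leP (I01_val t) c.
    exists 0; apply: near_const; apply/nbhs_I01P; exists 1 => // u _ ut.
    by rewrite /jump leNgt (lt_le_trans ut tc).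
  by exists 1; apply: near_const; have := lt_near t ct; apply: filterS => u.
- move=> t t1; have ct : c < I01_val t by rewrite t1.
  have jt : jump c t = 1 by rewrite /jump ltW.
  by rewrite /prop_for /continuous_at jt; apply: (near_const _ _ (nbhs_filter t)); exact: lt_near.
Qed.

Lemma nonseparable_D01 : ~ separable [set: sup_normed (D01 R s)].
Proof.
(* Halving keeps the jumps away from 1, where continuity is required. *)
have c1 (j : I01 R) : I01_val j / 2 < 1 by have /andP[] := I01_itv j; lra.
pose f j : sup_normed (D01 R s) :=
  SupNormed (mem_set (jump_cadlag (c1 j)) : _ \in bf_pred (D01 R s)).
apply: (nonseparable_family (f := f)) uncountable_I01 _.
have sep i j : I01_val i < I01_val j -> 1 <= rnorm (f i - f j).
  move=> ij; have /andP[i0 i1] := I01_itv i.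
  have [|t tE] := @exists_I01 R (I01_val i / 2); first by apply/andP; split; lra.
  apply: le_trans (rnorm_eval_le _ t).
  have -> : (f i - f j) t = jump (I01_val i / 2) t - jump (I01_val j / 2) t by [].
  rewrite /jump tE lexx (_ : I01_val j / 2 <= _ = false); last first.
    by apply/negbTE; rewrite -ltNge; lra.
  by rewrite subr0 /rnorm normr1 -(of_real1 R s) re_of_real.
move=> i j ij; have [/sep//|/sep|/I01_val_inj//] := ltgtP (I01_val i) (I01_val j).
by rewrite rnormB_sym.
Qed.

End nonseparability.

(** * A separated family of weakly continuous functions *)

Section nonseparable_Cw_lp.
Context (R : realType) (s : scalars) (p : R) (p1 : 1 < p).
Local Notation K := (scalar_field R s).
Local Notation I := (I01 R).
Local Notation lp := (lp s (ltW p1)).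
Local Notation e := (lp_unit s (ltW p1)).
Implicit Types (A : nat -> bool) (t : I).

Definition bump_sum A m t : lp :=
  \sum_(k < m) of_real s (if A k then hat k.+1 (I01_val t)^-1 else 0) *: e k.

(* For [t > 0] all the terms of the series [\sum_k hat k.+1 t^-1 *: e k] of index
   at least the bound below vanish; for [t = 0] all of them do, as [0^-1 = 0]. *)
Definition bump_series A t : lp := bump_sum A (Num.truncn (I01_val t)^-1).+1 t.

Lemma bump_seriesE A m t : (I01_val t)^-1 < m%:R -> bump_series A t = bump_sum A m t.
Proof.
move=> tm; have /andP[t0 _] := I01_itv t.
have nm : ((Num.truncn (I01_val t)^-1).+1 <= m)%N.
  by rewrite -(ltr_nat R) (le_lt_trans _ tm)// truncn_le// invr_ge0.
pose f k := of_real s (if A k then hat k.+1 (I01_val t)^-1 else 0) *: e k.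
rewrite /bump_series /bump_sum -!(big_mkord xpredT f).
rewrite [RHS](big_cat_nat (leq0n _) nm)/= [X in _ + X]big_nat_cond.
rewrite [X in _ + X]big1 ?addr0// => k /andP[/andP[nk _] _]; rewrite /f.
case: ifP => _; last by rewrite of_real0 scale0r.
rewrite hat_eq0 ?of_real0 ?scale0r// distrC ler_normr -natr1 addrAC lerDr subr_ge0.
have := truncnS_gt (I01_val t)^-1.
by rewrite -(ler_nat R) in nk => h; rewrite (le_trans (ltW h) nk).
Qed.

Lemma sum_hatS_le m (x : R) : 0 <= x <= m%:R -> \sum_(k < m) hat k.+1 x <= 1.
Proof.
by move=> /sum_hat <-; rewrite big_ord_recl lerDr hat_ge0.
Qed.

(** The weights are nonnegative with sum at most 1, and only the indices of nonzero weight matter.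
    The identity as [phi] yields boundedness, a functional yields weak continuity at 0. *)
Lemma rnorm_bump_sum_le A m t (W : normedModType K) (phi : {linear lp -> W}) (C : R) :
  0 <= C -> (I01_val t)^-1 <= m%:R ->
  (forall k, (k < m)%N -> hat k.+1 (I01_val t)^-1 = 0 \/ rnorm (phi (e k)) <= C) ->
  rnorm (phi (bump_sum A m t)) <= C.
Proof.
move=> C0 tm phiC; have /andP[t0 _] := I01_itv t.
apply: (@le_trans _ _ (\sum_(k < m) hat k.+1 (I01_val t)^-1 * C)); last first.
  by rewrite -mulr_suml -[leRHS]mul1r ler_wpM2r// sum_hatS_le// invr_ge0 t0.
rewrite /bump_sum linear_sum.
elim/big_ind2 : _ => [|? ? ? ? h1 h2|k _]; first by rewrite rnorm0.
  by rewrite (le_trans (ler_rnormD _ _))// lerD.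
rewrite linearZ rnormZr; case: ifP => _; last by rewrite normr0 mul0r mulr_ge0// hat_ge0.
rewrite ger0_norm ?hat_ge0//.
have [->|kC] := phiC k (ltn_ord k); first by rewrite !mul0r.
by rewrite ler_wpM2l ?hat_ge0.
Qed.

Lemma bump_series_bound A t : rnorm (bump_series A t) <= 1.
Proof.
have := truncnS_gt (I01_val t)^-1 => /ltW h.
apply: (@rnorm_bump_sum_le A _ t lp idfun 1) => // k _; right.
by rewrite rnorm_lp_unit.
Qed.

Lemma bump_sum_continuous A m t : 0 < I01_val t -> {for t, continuous (bump_sum A m)}.
Proof.
move=> t0; apply: (cvg_big (@add_continuous lp) (nbhs_filter t)) => k _.
case: (A k); last by rewrite of_real0; exact: cvg_cst.
apply/cvg_rnormP => d d0; have e1 := rnorm_lp_unit s (ltW p1) k.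
have hc : {for t, continuous (fun u : I => hat k.+1 (I01_val u)^-1)}.
  apply: (continuous_comp (f := fun u : I => (I01_val u)^-1)); last exact: hat_continuous.
  by apply: continuousV; [exact: lt0r_neq0|exact: I01_val_continuous].
have /cvgrPdist_lt/(_ _ d0) := hc; apply: filterS => u.
by rewrite -scalerBl -of_realN -of_realD rnormZr e1 mulr1.
Qed.

Lemma bump_series_weakly_continuous A : weakly_continuous (bump_series A).
Proof.
move=> phi cphi t; have /andP[t0 _] := I01_itv t; apply/continuous_rnormP => d d0.
have [t00|tn0] := eqVneq (I01_val t) 0.
  have d20 : 0 < d / 2 by rewrite divr_gt0.
  have [N NP] := lp_unit_weakly_null cphi d20.
  have -> : (phi \o bump_series A) t = 0.
    apply: rnorm_eq0; apply/eqP; rewrite eq_le rnorm_ge0 andbT /=.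
    apply: rnorm_bump_sum_le => // [|k _]; first by rewrite ltW// truncnS_gt.
    by left; rewrite t00 invr0 hat_eq0// sub0r normrN ger0_norm// ler1n.
  (* For [0 < u < 1 / N.+1] the tents centred at [k.+1 <= N] vanish at [1 / u], so only indices
     [k >= N] remain. *)
  apply/nbhs_I01P; exists (N.+1%:R^-1); first by rewrite invr_gt0.
  move=> u; rewrite t00 sub0r normrN => uN; have /andP[u0 _] := I01_itv u.
  rewrite ger0_norm// in uN; rewrite sub0r rnormN /=.
  apply: (@le_lt_trans _ _ (d / 2)); last lra.
  apply: rnorm_bump_sum_le; [exact: ltW|by rewrite ltW// truncnS_gt|move=> k _].
  have [Nk|kN] := leqP N k; [by right; rewrite ltW// NP|left; apply: hat_eq0].
  have [->|un0] := eqVneq (I01_val u) 0; first by rewrite invr0 sub0r normrN ger0_norm// ler1n.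
  have {un0}u0 : 0 < I01_val u by rewrite lt_def un0.
  rewrite ler_normr; apply/orP; left; rewrite lerBrDl.
  apply: (@le_trans _ _ N.+1%:R); first by rewrite natr1 ler_nat.
  by rewrite -[leLHS]invrK lef_pV2 ?ltW// posrE// invr_gt0.
have {tn0}t0 : 0 < I01_val t by rewrite lt_def tn0.
(* For [u > t / 2] one has [1 / u < 2 / t < m], so near [t] the series is a single finite sum,
   continuous in norm. *)
pose m := (Num.truncn (2 / I01_val t)).+1.
have um u : I01_val t / 2 < I01_val u -> bump_series A u = bump_sum A m u.
  move=> tu; apply: bump_seriesE; apply: le_lt_trans (truncnS_gt _).
  have h : 0 < I01_val t / 2 by rewrite divr_gt0.
  by rewrite -[leRHS]invrK lef_pV2 ?posrE ?invr_gt0 ?divr_gt0// ?invf_div ?ltW// (lt_trans h).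
have := @continuous_comp _ _ _ (bump_sum A m) phi t (@bump_sum_continuous A m t t0) (cphi _).
move=> /continuous_rnormP/(_ _ d0) c1.
have c2 : \forall u \near t, I01_val t / 2 < I01_val u.
  apply/nbhs_I01P; exists (I01_val t / 2); first by rewrite divr_gt0.
  by move=> u; rewrite ltr_norml => /andP[_ ?]; lra.
apply: filterS2 c1 c2 => u /= + /um ->; rewrite um//.
by rewrite ltr_pdivrMr// ltr_pMr// ltr1n.
Qed.

Lemma bump_series_Cw A : Cw_carrier (bump_series A).
Proof.
split; first exact: bump_series_weakly_continuous.
exists 1; split; first exact: real1.
move=> x x1 t _ /=; apply: le_trans (ltW x1).
by rewrite -(of_real1 R s) normr_rnorm bump_series_bound.
Qed.

Lemma bump_series_node A t n : I01_val t = n.+1%:R^-1 ->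
  bump_series A t = if A n then e n else 0.
Proof.
move=> tn; rewrite (@bump_seriesE _ n.+2) ?tn ?invrK ?ltr_nat// /bump_sum tn invrK.
have n2 : (n < n.+2)%N by [].
rewrite (bigD1 (Ordinal n2))//= big1 ?addr0.
  have -> : hat n.+1 n.+1%:R = 1 :> R.
    by rewrite /hat subrr add0r !rampE; do ![case: ifP] => *; lra.
  by case: ifP => _; rewrite ?of_real1 ?scale1r ?of_real0 ?scale0r.
move=> k /eqP kn0; case: ifP => _; last by rewrite of_real0 scale0r.
rewrite hat_eq0 ?of_real0 ?scale0r//.
have kn : k <> n :> nat by move=> kn; apply: kn0; exact: val_inj.
rewrite ler_normr opprB !lerBrDr !nat1r !ler_nat.
by lia.
Qed.

Lemma nonseparable_Cw_lp : ~ separable [set: sup_normed (Cw I lp)].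
Proof.
pose f A : sup_normed (Cw I lp) :=
  SupNormed (mem_set (bump_series_Cw A) : _ \in bf_pred (Cw I lp)).
apply: (nonseparable_family (f := f)) uncountable_bool_sequences _ => A B AB.
have [n nAB] : exists n, A n != B n.
  apply: contrapT => nex; apply: AB; apply/funext => n.
  by apply/eqP; apply: contrapT => /negP ?; apply: nex; exists n.
(* At [1 / n.+1] only the tent of index [n.+1] is nonzero, so the two functions differ there by a
   unit vector up to sign. *)
have [|t tE] := @exists_I01 R n.+1%:R^-1.
  by rewrite invr_ge0 ler0n invf_le1 ?ltr0n// ler1n.
apply: le_trans (rnorm_eval_le _ t).
have -> : (f A - f B) t = bump_series A t - bump_series B t by [].
rewrite !(bump_series_node _ tE); move: nAB.
by case: (A n); case: (B n) => // _; rewrite ?subr0 ?sub0r ?rnormN rnorm_lp_unit.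
Qed.

End nonseparable_Cw_lp.

Theorem corollary3p5 (R : realType) (s : scalars) :
  [/\ rich (C_sub (D01 R s)),
      separable (C_sub (D01 R s)) &
      ~ separable [set: sup_normed (D01 R s)]] /\
  (forall (T : topologicalType) (E : completeNormedModType (scalar_field R s)),
    compact [set: T] -> hausdorff_space T -> perfect_set [set: T] ->
    rich (C_sub (Cw T E))) /\
  (forall (p : R) (p1 : 1 < p),
    [/\ rich (C_sub (Cw (I01 R) (lp s (ltW p1)))),
        separable (C_sub (Cw (I01 R) (lp s (ltW p1)))) &
        ~ separable [set: sup_normed (Cw (I01 R) (lp s (ltW p1)))]]).
Proof.
split; [split|split].
- exact: rich_D01.
- by apply: separable_C_sub_I01; [exact: continuous_cadlag|exact: separable_scalars].
- exact: nonseparable_D01.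
- by move=> T E; exact: rich_Cw.
- move=> p p1; split.
  + apply: rich_Cw; [exact: compact_I01|exact: I01_hausdorff|exact: I01_perfect].
  + apply: separable_C_sub_I01; last exact: separable_lp.
    by move=> f; apply: continuous_Cw; exact: compact_I01.
  + exact: nonseparable_Cw_lp.
Qed.
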